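(* Let $\mathfrak{A}$ be a unital $C^*$-algebra. For any spreadable state $\varphi$ on $\ast_{\mathbb{N}}\mathfrak{A}$ one has $$\mathcal{R}_{\varphi_{\mathbb{Z}}}^{\tau}=\mathcal{T}_{\varphi_{\mathbb{Z}}}.$$ Moreover, the restriction map $\Phi:\mathcal{T}_{\varphi_{\mathbb{Z}}}\to\mathcal{T}_\varphi$ is a $*$-isomorphism. If $\varphi$ is also exchangeable, then one has $$\mathcal{R}_{\varphi_{\mathbb{Z}}}^{\mathbb{P}_{\mathbb{Z}}}=\mathcal{R}_{\varphi_{\mathbb{Z}}}^{\tau}=\mathcal{T}_{\varphi_{\mathbb{Z}}}.$$
   Context: $\mathbb{N}=\{0,1,2,\dots\}$. $\ast_{\mathbb{N}}\mathfrak{A}$ and $\ast_{\mathbb{Z}}\mathfrak{A}$ are the unital free product $C^*$-algebras (units amalgamated) of copies of $\mathfrak{A}$ indexed by $\mathbb{N}$, resp. $\mathbb{Z}$, with canonical unital embeddings $i_j$; $\ast_{\mathbb{N}}\mathfrak{A}\subset\ast_{\mathbb{Z}}\mathfrak{A}$. For an injective map $f$ of the index set, $\alpha_f$ is the unital $*$-endomorphism with $\alpha_f(i_j(a))=i_{f(j)}(a)$; $\tau$ is the shift, $\tau(i_j(a))=i_{j+1}(a)$ (an automorphism on $\ast_{\mathbb{Z}}\mathfrak{A}$). $\mathbb{P}_{\mathbb{N}}$, $\mathbb{P}_{\mathbb{Z}}$ are the groups of bijections of $\mathbb{N}$, $\mathbb{Z}$ moving only finitely many points; $\mathbb{J}_{\mathbb{N}}$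 is the semigroup of strictly increasing maps $h:\mathbb{N}\to\mathbb{N}$ with $|\mathbb{N}\setminus h(\mathbb{N})|<\infty$. A state $\varphi$ on $\ast_{\mathbb{N}}\mathfrak{A}$ is spreadable if $\varphi\circ\alpha_h=\varphi$ for all $h\in\mathbb{J}_{\mathbb{N}}$, and exchangeable if $\varphi\circ\alpha_\sigma=\varphi$ for all $\sigma\in\mathbb{P}_{\mathbb{N}}$; both imply $\varphi\circ\tau=\varphi$. $\varphi_{\mathbb{Z}}$ is the unique shift-invariant state on $\ast_{\mathbb{Z}}\mathfrak{A}$ extending $\varphi$, with GNS triple $(\pi_{\varphi_{\mathbb{Z}}},\mathcal{H}_{\varphi_{\mathbb{Z}}},\xi_{\varphi_{\mathbb{Z}}})$. If $\varphi$ is exchangeable, $\varphi_{\mathbb{Z}}$ is invariant under $\alpha_\sigma$, $\sigma\in\mathbb{P}_{\mathbb{Z}}$. $U_\tau$ and $U_\sigma$ are the unitaries on $\mathcal{H}_{\varphi_{\mathbb{Z}}}$ given by $U_\tau\pi_{\varphi_{\mathbb{Z}}}(x)\xi_{\varphi_{\mathbb{Z}}}=\pi_{\varphi_{\mathbb{Z}}}(\tau(x))\xi_{\varphi_{\mathbb{Z}}}$ and $U_\sigma\pi_{\varphi_{\mathbb{Z}}}(x)\xi_{\varphi_{\mathbb{Z}}}=\pi_{\varphi_{\mathbb{Z}}}(\alpha_\sigma(x))\xi_{\varphi_{\mathbb{Z}}}$, $x\in\ast_{\mathbb{Z}}\mathfrak{A}$. Set $\mathcal{R}_{\varphi_{\mathbb{Z}}}:=\pi_{\varphi_{\mathbb{Z}}}(\ast_{\mathbb{N}}\mathfrak{A})''$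 (generated only by the indices in $\mathbb{N}$), $\mathcal{T}_{\varphi_{\mathbb{Z}}}:=\bigcap_{n\in\mathbb{N}}\{\pi_{\varphi_{\mathbb{Z}}}(i_k(\mathfrak{A})):k\ge n\}''$, $\mathcal{R}_{\varphi_{\mathbb{Z}}}^\tau:=\{T\in\mathcal{R}_{\varphi_{\mathbb{Z}}}:TU_\tau=U_\tau T\}$, $\mathcal{R}_{\varphi_{\mathbb{Z}}}^{\mathbb{P}_{\mathbb{Z}}}:=\{T\in\mathcal{R}_{\varphi_{\mathbb{Z}}}:TU_\sigma=U_\sigma T,\ \sigma\in\mathbb{P}_{\mathbb{Z}}\}$. The subspace $\mathcal{H}_{\mathbb{N}}:=\overline{\pi_{\varphi_{\mathbb{Z}}}(\ast_{\mathbb{N}}\mathfrak{A})\xi_{\varphi_{\mathbb{Z}}}}$ is $\ast_{\mathbb{N}}\mathfrak{A}$-invariant and is identified with the GNS space $\mathcal{H}_\varphi$ of $\varphi$. $\mathcal{R}_\varphi:=\pi_\varphi(\ast_{\mathbb{N}}\mathfrak{A})''$, $\mathcal{T}_\varphi:=\bigcap_{n\in\mathbb{N}}\{\pi_\varphi(i_k(\mathfrak{A})):k\ge n\}''$, and $\Phi:\mathcal{R}_{\varphi_{\mathbb{Z}}}\to\mathcal{R}_\varphi$ is $\Phi(T)=T\upharpoonright_{\mathcal{H}_{\mathbb{N}}}$. *)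

(* Defs.v *)
From HB Require Import structures.
From mathcomp Require Import all_boot all_order all_algebra.
From mathcomp Require Import sesquilinear.
From mathcomp Require Import complex.
From mathcomp Require Import all_classical all_reals all_analysis.

Set Implicit Arguments.
Unset Strict Implicit.
Unset Printing Implicit Defensive.

Import Order.TTheory GRing.Theory Num.Theory.
Import numFieldNormedType.Exports.

Local Open Scope classical_set_scope.
Local Open Scope ring_scope.

(* The product is declared here rather than inherited from [GRing.Algebra]:
   Hierarchy Builder admits no join of that structure with normed modules. *)
HB.mixin Record NormedModule_isCStar (K : numClosedFieldType) A
    of CompleteNormedModule K A := {
  cone : A;
  cmul : A -> A -> A;
  star : A -> A;
  cmulA : associative cmul;
  cmul1x : left_id cone cmul;
  cmulx1 : right_id cone cmul;
  cmul_linearl : forall y : A, linear (cmul ^~ y);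
  cmul_linearr : forall x : A, linear (cmul x);
  cmul_norm : forall x y : A, `|cmul x y| <= `|x| * `|y|;
  starK : involutive star;
  starD : forall x y : A, star (x + y) = star x + star y;
  starZ : forall (c : K) (x : A), star (c *: x) = c^* *: star x;
  starM : forall x y : A, star (cmul x y) = cmul (star y) (star x);
  cstar_norm : forall x : A, `|cmul (star x) x| = `|x| ^+ 2
}.

#[short(type="cstarAlgType")]
HB.structure Definition CStarAlgebra (K : numClosedFieldType) :=
  {A of CompleteNormedModule K A & NormedModule_isCStar K A}.

Arguments cone {K s}.

(* The inner product [dotp] is linear in its first argument. *)
HB.mixin Record NormedModule_isHilbert (K : numClosedFieldType) H
    of CompleteNormedModule K H := {
  dotp : {dot H for @Num.conj K};
  normr_dotp : forall x : H, `|x| ^+ 2 = dotp x x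
}.

#[short(type="hilbertType")]
HB.structure Definition Hilbert (K : numClosedFieldType) :=
  {H of CompleteNormedModule K H & NormedModule_isHilbert K H}.

Section CStar.
Context {K : numClosedFieldType}.

Definition star_morphism (A B : cstarAlgType K) (f : A -> B) : Prop :=
  [/\ linear f, f cone = cone,
      forall a b, f (cmul a b) = cmul (f a) (f b) &
      forall a, f (star a) = star (f a)].

Definition closed_star_subalgebra (A : cstarAlgType K) (B : set A) : Prop :=
  [/\ closed B, B cone,
      forall (c : K) x y, B x -> B y -> B (c *: x + y),
      forall x y, B x -> B y -> B (cmul x y) &
      forall x, B x -> B (star x)].

Definition cstar_generated (A : cstarAlgType K) (S : set A) : set A :=
  smallest (@closed_star_subalgebra A) S.

(* The unital free product of copies of [A] indexed by [I]. Being generated by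
   the copies of [A] and the uniqueness in the universal property imply each
   other in the presence of the other clauses. *)
Record freeProduct (A : cstarAlgType K) (I : Type) := FreeProduct {
  fp_alg :> cstarAlgType K;
  fp_emb : I -> A -> fp_alg;
  fp_emb_morphism : forall j, star_morphism (fp_emb j);
  fp_generated : cstar_generated [set x | exists j a, x = fp_emb j a] = setT;
  fp_universal : forall (D : cstarAlgType K) (f : I -> A -> D),
    (forall j, star_morphism (f j)) ->
    exists! g : fp_alg -> D,
      star_morphism g /\ forall j a, g (fp_emb j a) = f j a
}.

Arguments fp_emb [A I] f j a : rename.

(* For I = J this is alpha_f. *)
Definition fp_map (A : cstarAlgType K) (I J : Type) (P : freeProduct A I)
    (Q : freeProduct A J) (f : I -> J) : P -> Q :=
  xget (fun=> 0) [set g : P -> Q | star_morphism g /\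
    forall j a, g (fp_emb P j a) = fp_emb Q (f j) a].

Arguments fp_map [A I J] P Q f.

Definition is_state (A : cstarAlgType K) (phi : A -> K) : Prop :=
  [/\ scalar phi, forall x, `|phi x| <= `|x|,
      forall x, 0 <= phi (cmul (star x) x) & phi cone = 1].

Definition finitary_perm (I : Type) : set (I -> I) :=
  [set s : I -> I | bijective s /\ finite_set [set i | s i <> i]].

Definition cofinite_increasing : set (nat -> nat) :=
  [set h : nat -> nat | {homo h : m n / (m < n)%N} /\ finite_set (~` range h)].

Section Symmetries.
Variables (A : cstarAlgType K) (P : freeProduct A nat) (phi : P -> K).

Definition spreadable : Prop :=
  forall h, cofinite_increasing h -> phi \o fp_map P P h = phi.

Definition exchangeable : Prop :=
  forall s, finitary_perm s -> phi \o fp_map P P s = phi.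

End Symmetries.

Section Operators.
Variable H : hilbertType K.

Definition bounded_op : set (H -> H) := [set T | linear T /\ continuous T].

Definition adjoint_of (T S : H -> H) : Prop :=
  forall u v, dotp (T u) v = dotp u (S v).

Definition unitary_op : set (H -> H) :=
  [set U | [/\ linear U, forall u v, dotp (U u) (U v) = dotp u v &
               range U = setT]].

Definition commutant (S : set (H -> H)) : set (H -> H) :=
  [set T | bounded_op T /\ forall X, S X -> T \o X = X \o T].

Definition bicommutant (S : set (H -> H)) : set (H -> H) :=
  commutant (commutant S).

End Operators.

Record gns (A : cstarAlgType K) (phi : A -> K) := Gns {
  gns_space :> hilbertType K;
  gns_rep : A -> gns_space -> gns_space;
  gns_vec : gns_space;
  gns_rep_bounded : forall a, bounded_op (gns_rep a);
  gns_rep_linear : forall (c : K) a b v,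
    gns_rep (c *: a + b) v = c *: gns_rep a v + gns_rep b v;
  gns_rep1 : gns_rep cone = id;
  gns_repM : forall a b, gns_rep (cmul a b) = gns_rep a \o gns_rep b;
  gns_rep_star : forall a, adjoint_of (gns_rep a) (gns_rep (star a));
  gns_cyclic : closure (range (gns_rep ^~ gns_vec)) = setT;
  gns_state : forall a, phi a = dotp (gns_rep a gns_vec) gns_vec
}.

Arguments gns_rep [A phi] g a v : rename.
Arguments gns_vec [A phi] g.

Definition implements (A : cstarAlgType K) (phi : A -> K) (G : gns phi)
    (alpha : A -> A) (U : G -> G) : Prop :=
  unitary_op U /\
  forall x, U (gns_rep G x (gns_vec G)) = gns_rep G (alpha x) (gns_vec G).

(* [F], restricted to the operator algebra [M], is a *-isomorphism onto [N]. *)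
Definition star_isomorphism (H L : hilbertType K) (M : set (H -> H))
    (N : set (L -> L)) (F : (H -> H) -> (L -> L)) : Prop :=
  [/\ set_bij M N F,
      forall (c : K) S T, M S -> M T -> F (c \*: S \+ T) = c \*: F S \+ F T,
      forall S T, M S -> M T -> F (S \o T) = F S \o F T &
      forall S T, M S -> M T -> adjoint_of S T -> adjoint_of (F S) (F T)].

Section OneSided.
Variables (A : cstarAlgType K) (PN : freeProduct A nat).
Variables (phi : PN -> K) (G : gns phi).

Definition tail_algebra : set (G -> G) :=
  \bigcap_(n : nat) bicommutant
    [set T | exists k a, (n <= k)%N /\ T = gns_rep G (fp_emb PN k a)].

End OneSided.

Section TwoSided.
Variables (A : cstarAlgType K) (PN : freeProduct A nat) (PZ : freeProduct A int).

Definition fp_incl : PN -> PZ := fp_map PN PZ Posz.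

Definition fp_shift : PZ -> PZ := fp_map PZ PZ (fun k => k + 1).

Variables (phiZ : PZ -> K) (GZ : gns phiZ).

Definition algR : set (GZ -> GZ) :=
  bicommutant (range (fun x : PN => gns_rep GZ (fp_incl x))).

Definition tail_algebraZ : set (GZ -> GZ) :=
  \bigcap_(n : nat) bicommutant
    [set T | exists (k : int) a,
       n%:Z <= k /\ T = gns_rep GZ (fp_emb PZ k a)].

Definition fixed_shift (Utau : GZ -> GZ) : set (GZ -> GZ) :=
  [set T | algR T /\ T \o Utau = Utau \o T].

Definition fixed_perm (Us : (int -> int) -> GZ -> GZ) : set (GZ -> GZ) :=
  [set T | algR T /\
           forall s, finitary_perm s -> T \o Us s = Us s \o T].

Definition spaceN : set GZ :=
  closure (range (fun x : PN => gns_rep GZ (fp_incl x) (gns_vec GZ))).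

Variables (phi : PN -> K) (G : gns phi).

(* [V] is the unitary from the GNS space of [phi] onto the subspace [spaceN]
   that identifies the two as GNS spaces of [phi]. *)
Definition gns_identification (V : G -> GZ) : Prop :=
  [/\ linear V, forall u v, dotp (V u) (V v) = dotp u v, range V = spaceN &
      forall x, V (gns_rep G x (gns_vec G)) =
                gns_rep GZ (fp_incl x) (gns_vec GZ)].

(* T |-> T restricted to [spaceN], read as an operator on [G] through [V]:
   the value at [v] is the unique [w] with V w = T (V v). *)
Definition restriction (V : G -> GZ) (T : GZ -> GZ) : G -> G :=
  fun v => xget 0 [set w | V w = T (V v)].

End TwoSided.
End CStar.

Arguments fp_incl {K A} PN PZ.
Arguments fp_shift {K A} PZ.
Arguments tail_algebra {K A PN phi} G.
Arguments algR {K A} PN [PZ phiZ] GZ.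
Arguments tail_algebraZ {K A PZ phiZ} GZ.
Arguments fixed_shift {K A} PN [PZ phiZ GZ] Utau.
Arguments fixed_perm {K A} PN [PZ phiZ GZ] Us.
Arguments spaceN {K A} PN [PZ phiZ] GZ.
Arguments fp_emb {K A I} f j a : rename.
Arguments fp_map {K A I J} P Q f.
Arguments gns_rep {K A phi} g a v : rename.
Arguments gns_vec {K A phi} g.

(* Main.v *)
Require Import Defs.
From mathcomp Require Import all_boot all_order all_algebra.
From mathcomp Require Import sesquilinear complex ring lra zify.
From mathcomp Require Import all_classical all_reals all_analysis.

(** Write pi, xi and U for the two-sided representation, its cyclic vector and
    the unitary of the shift, M_n for the commutant of the operators
    pi (i_k a) with k >= n, and R_n for the commutant of M_n, so that the tail
    algebra is the intersection of the R_n.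

    Every tail operator T commutes with U. The strictly increasing map of Z
    that moves the indices below n one step down and fixes the others
    ([left_shift]) leaves phiZ invariant: after a large translation it becomes
    an increasing map of N missing a single point, and phi is spreadable
    ([phiZ_left_shift]). It is therefore implemented by an isometry W_n, which
    belongs to M_n since it fixes all indices >= n ([left_shift_op]), and
    W_n U v = v for the vectors v = pi x xi in which x only has indices below
    n - 1. As T commutes with W_n, <T v, w> = <T U v, U w> for all such v and w;
    n being arbitrary, T = U^-1 T U ([tail_commutes_shift]). Conversely
    conjugation by U^n maps R_0 onto R_n, so an element of R_0 commuting with U
    lies in every R_n ([fixed_shiftE]).

    For the restriction, let V be the isometry from the one-sided space.
    The projection onto its range belongs to M_0, whence restricting T amounts
    to taking V^* T V. Restriction is injective on the tail algebra because T
    commutes with U and the subspaces U^-m (range V) have a dense union. For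
    surjectivity, a tail operator S of the one-sided representation commutes
    with V^* W_n V, which gives <S u, w> = <S s u, s w> for the one-sided shift
    isometry s = V^* U V; applied also to S^* S, this gives S s = s S
    ([tail_commutes_Vt]). Hence U^-m V u |-> U^-m V S u is well defined, and it
    extends to an operator T commuting with U whose restriction is S; that T
    belongs to R_0 follows by shifting far to the right, where S commutes with
    the compressions of the elements of M_m ([restriction_surj]).

    For exchangeable states, a finite permutation fixes all large indices, so
    its unitary lies in some M_n and commutes with the tail; in the other
    direction, on vectors with finitely many indices U agrees with the unitary
    of a cyclic permutation ([perm_commutes_shift]).

    Two analytic facts support this. Operators are built on dense subspaces and
    then extended, and adjoints come from the Riesz theorem
    ([dense_relation_extends], [riesz]). And representations are contractive
    ([rep_contractive]), so that operators commuting with the generators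
    pi (i_k a), k >= 0, commute with pi x for every x in the free product over
    N ([algR_gens]). *)

Set Implicit Arguments.
Unset Strict Implicit.
Unset Printing Implicit Defensive.

Import Order.TTheory GRing.Theory Num.Theory.
Import numFieldNormedType.Exports.
Local Open Scope classical_set_scope.
Local Open Scope ring_scope.
Local Open Scope complex_scope.

(** * Real-valued norms and inner products *)
Lemma ReD (R : rcfType) (a b : R[i]) :
  complex.Re (a + b) = complex.Re a + complex.Re b.
Proof. by case: a b => ? ? []. Qed.

Lemma ReN (R : rcfType) (a : R[i]) : complex.Re (- a) = - complex.Re a.
Proof. by case: a. Qed.

Section RealNorm.
Context {R : realType}.
Implicit Types V : normedModType R[i].

(** The order of [R[i]] is partial. All estimates are made in the totally
    ordered field [R], where norms live. *)
Definition nm (V : normedZmodType R[i]) (x : V) : R := complex.Re `|x|.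

Lemma nmE (V : normedZmodType R[i]) (x : V) : `|x| = (nm x)%:C.
Proof. by rewrite /nm RRe_real. Qed.

Lemma nm_ge0 (V : normedZmodType R[i]) (x : V) : 0 <= nm x.
Proof. by rewrite -ler0c -nmE. Qed.

Lemma nmD (V : normedZmodType R[i]) (x y : V) : nm (x + y) <= nm x + nm y.
Proof. by rewrite -lecR rmorphD/= -!nmE ler_normD. Qed.

Lemma nmN (V : normedZmodType R[i]) (x : V) : nm (- x) = nm x.
Proof. by rewrite /nm normrN. Qed.

Lemma nmB (V : normedZmodType R[i]) (x y : V) : nm (x - y) = nm (y - x).
Proof. by rewrite /nm distrC. Qed.

Lemma nm0 (V : normedZmodType R[i]) : nm (0 : V) = 0.
Proof. by rewrite /nm normr0. Qed.

Lemma nm_eq0 (V : normedZmodType R[i]) (x : V) : nm x = 0 -> x = 0.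
Proof. by move=> x0; apply/eqP; rewrite -normr_eq0 nmE x0. Qed.

Lemma nm_triangle (V : normedZmodType R[i]) (y x z : V) :
  nm (x - z) <= nm (x - y) + nm (y - z).
Proof. by apply: le_trans (nmD _ _); rewrite addrA subrK. Qed.

Lemma nmZ V (c : R[i]) (x : V) : nm (c *: x) = nm c * nm x.
Proof. by apply: complexI; rewrite rmorphM/= -!nmE normrZ. Qed.

Lemma nmRC (r : R) : 0 <= r -> nm r%:C = r.
Proof. by move=> r0; rewrite /nm ger0_norm ?ler0c. Qed.

Lemma nm_arbitrarily_small (V : normedZmodType R[i]) (x : V) :
  (forall e : R, 0 < e -> nm x <= e) -> x = 0.
Proof.
move=> h; apply: nm_eq0; apply/le_anti; rewrite nm_ge0 andbT.
by apply/ler_addgt0Pl => e e0; rewrite addr0; exact: h.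
Qed.

Lemma Re_le_nm (c : R[i]) : complex.Re c <= nm c.
Proof.
have := normc_ge_Re c; rewrite nmE lecR; apply: le_trans; exact: ler_norm.
Qed.

Lemma nbhs_nmP (V : normedModType R[i]) (x : V) (B : set V) :
  nbhs x B <-> exists2 e : R, 0 < e & forall y, nm (x - y) < e -> B y.
Proof.
split=> [/nbhs_ballP[e /= e0 eB]|[e e0 eB]].
  have eR : e = (complex.Re e)%:C by rewrite RRe_real // ger0_real // ltW.
  exists (complex.Re e); first by rewrite -ltcR -eR.
  by move=> y xy; apply: eB; rewrite -ball_normE /= nmE eR ltcR.
apply/nbhs_ballP; exists e%:C => /=; first by rewrite ltcR.
by move=> y; rewrite -ball_normE /= nmE ltcR => /eB.
Qed.

Lemma closureP_nm (V : normedModType R[i]) (B : set V) (x : V) :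
  closure B x <-> forall e : R, 0 < e -> exists2 y, B y & nm (x - y) < e.
Proof.
split=> [Bx e e0|h C /nbhs_nmP[e e0 eC]].
  have [y [By xy]] : B `&` [set y | nm (x - y) < e] !=set0.
    by apply: Bx; apply/nbhs_nmP; exists e.
  by exists y.
by have [y By xy] := h e e0; exists y; split => //; exact: eC.
Qed.

(** Completeness for a family of approximations of precision [e]: the sets of
    points of [P d] with [d <= e] form a base of a Cauchy filter. *)
Lemma approximants_converge (V : completeNormedModType R[i]) (P : R -> set V) :
  (forall e, 0 < e -> P e !=set0) ->
  (forall e d x y, 0 < e -> 0 < d -> P e x -> P d y -> nm (x - y) <= e + d) ->
  exists w, forall e x, 0 < e -> P e x -> nm (x - w) <= e.
Proof.
move=> P0 Pd.
pose Q (e : R) : set V := [set x | exists2 d, 0 < d <= e & P d x].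
pose F := filter_from [set e : R | 0 < e] Q.
have FF : ProperFilter F.
  apply: filter_from_proper; last first.
    by move=> e /= e0; have [x Px] := P0 _ e0; exists x, e; rewrite ?e0/=.
  apply: filter_from_filter; first by exists 1 => /=.
  move=> e d /= e0 d0; exists (Num.min e d); first by rewrite /= lt_min e0 d0.
  move=> x [c /andP[c0 ced] Pc]; move: ced; rewrite le_min => /andP[ce cd].
  by split; exists c; rewrite ?c0.
have /cauchy_cvg/cvg_ex[w Fw] : cauchy F.
  apply/cauchy_exP => e e0.
  have eR : e = (complex.Re e)%:C by rewrite RRe_real // ger0_real // ltW.
  have r0 : 0 < complex.Re e by rewrite -ltcR -eR.
  set r := complex.Re e in eR r0.
  have r40 : 0 < r / 4 by lra.
  have [x Px] := P0 _ r40; exists x; exists (r / 4) => //=.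
  move=> y [d /andP[d0 dr] Py].
  rewrite -ball_normE /= nmE eR ltcR.
  by have := Pd _ _ _ _ r40 d0 Px Py; lra.
exists w => e x e0 Px.
apply/ler_addgt0Pr => d d0.
have [c c0 cw] : F [set y | nm (w - y) < d / 2].
  by apply: Fw; apply/nbhs_nmP; exists (d / 2); first lra.
have m0 : 0 < Num.min c (d / 2) by rewrite lt_min c0; lra.
have [y Py] := P0 _ m0.
have wy : nm (w - y) < d / 2.
  by apply: cw; exists (Num.min c (d / 2)); rewrite // m0 ge_min lexx.
have := Pd _ _ _ _ e0 m0 Px Py.
have := nm_triangle y x w; rewrite (nmB y w).
have : Num.min c (d / 2) <= d / 2 by rewrite ge_min lexx orbT.
lra.
Qed.

End RealNorm.

Section Inner.
Context {R : realType}.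
Implicit Types H L : hilbertType R[i].

(** The real part determines the whole inner product ([dotp_rdot]), so adjoints
    and equality of vectors can be tested on it. *)
Definition rdot H (u v : H) : R := complex.Re (dotp u v).

Lemma dotpC H (u v : H) : dotp u v = (dotp v u)^*.
Proof. by rewrite hermC expr0 mul1r. Qed.

Lemma rdotC H (u v : H) : rdot u v = rdot v u.
Proof. by rewrite /rdot dotpC; case: (dotp v u). Qed.

Lemma rdotDl H (u v w : H) : rdot (u + v) w = rdot u w + rdot v w.
Proof. by rewrite /rdot linearDl ReD. Qed.

Lemma rdotDr H (u v w : H) : rdot w (u + v) = rdot w u + rdot w v.
Proof. by rewrite rdotC rdotDl !(rdotC w). Qed.

Lemma rdotNl H (u w : H) : rdot (- u) w = - rdot u w.
Proof. by rewrite /rdot linearNl ReN. Qed.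

Lemma rdotNr H (u w : H) : rdot w (- u) = - rdot w u.
Proof. by rewrite rdotC rdotNl rdotC. Qed.

Lemma rdotBl H (u v w : H) : rdot (u - v) w = rdot u w - rdot v w.
Proof. by rewrite rdotDl rdotNl. Qed.

Lemma rdotBr H (u v w : H) : rdot w (u - v) = rdot w u - rdot w v.
Proof. by rewrite rdotDr rdotNr. Qed.

Lemma dotpZl H (c : R[i]) (u w : H) : dotp (c *: u) w = c * dotp u w.
Proof. by rewrite linearZl_LR. Qed.

Lemma dotpPl H (c : R[i]) (u v w : H) :
  dotp (c *: u + v) w = c * dotp u w + dotp v w.
Proof. exact: linearPl. Qed.

Lemma dotpPr H (c : R[i]) (u v w : H) :
  dotp w (c *: u + v) = c^* * dotp w u + dotp w v.
Proof. exact: linearPr. Qed.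

Lemma rdotZl H (r : R) (u w : H) : rdot (r%:C *: u) w = r * rdot u w.
Proof. by rewrite /rdot dotpZl; case: (dotp u w) => a b /=; rewrite mul0r subr0. Qed.

Lemma rdotZr H (r : R) (u w : H) : rdot w (r%:C *: u) = r * rdot w u.
Proof. by rewrite rdotC rdotZl rdotC. Qed.

Lemma rdotE H (u : H) : rdot u u = nm u ^+ 2.
Proof. by rewrite /rdot -normr_dotp nmE -rmorphXn. Qed.

Lemma dotp_rdot H (u v : H) : dotp u v = (rdot u v) +i* (rdot ((- 'i) *: u) v).
Proof.
rewrite /rdot dotpZl; case: (dotp u v) => a b /=.
by congr Complex; rewrite oppr0; ring.
Qed.

(** The square norm of [u - t v] is a nonnegative quadratic polynomial in the
    real number [t]. *)
Lemma cauchy_schwarz H (u v : H) : rdot u v <= nm u * nm v.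
Proof.
have h (t : R) : 0 <= nm u ^+ 2 - 2 * t * rdot u v + t ^+ 2 * nm v ^+ 2.
  have := nm_ge0 (u - t%:C *: v) => h.
  have -> : nm u ^+ 2 - 2 * t * rdot u v + t ^+ 2 * nm v ^+ 2 =
    nm (u - t%:C *: v) ^+ 2; last by rewrite exprn_ge0.
  by rewrite -!rdotE rdotBl !rdotBr !rdotZl !rdotZr (rdotC v u); ring.
have := nm_ge0 u; have := nm_ge0 v.
rewrite le0r => /orP[/eqP v0|v0] u0.
  by rewrite (nm_eq0 v0) nm0 mulr0 -[in X in rdot _ X](subrr v) rdotBr subrr.
have := h (nm u / nm v).
have e1 : 2 * (nm u / nm v) * rdot u v = 2 * (nm u * (rdot u v / nm v)).
  by field; rewrite gt_eqF.
rewrite e1 exprMn exprVn mulfVK ?sqrf_eq0 ?gt_eqF //.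
move: u0; rewrite le0r => /orP[/eqP u0|u0].
  by move=> _; rewrite (nm_eq0 u0) nm0 mul0r -[in X in rdot X _](subrr u) rdotBl subrr.
move=> h2; have : nm u * (rdot u v / nm v) <= nm u * nm u by lra.
by rewrite ler_pM2l // ler_pdivrMr.
Qed.

Lemma rdot_eq H (u v : H) : (forall w, rdot u w = rdot v w) -> u = v.
Proof.
move=> h; apply/subr0_eq/nm_eq0/eqP; rewrite -sqrf_eq0 -rdotE rdotBl h.
by rewrite subrr.
Qed.

(** If [u - v] is orthogonal to [w], then [rdot (u - v) (u - v)] equals
    [rdot (u - v) (u - v - w)], which is small for [w] close to [u - v]. *)
Lemma rdot_eq_dense H (B : set H) (u v : H) :
  (forall v e, 0 < e -> exists2 u, B u & nm (v - u) < e) ->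
  (forall w, B w -> rdot u w = rdot v w) -> u = v.
Proof.
move=> dB h; apply/subr0_eq/nm_arbitrarily_small => e e0.
have [w Bw wd] := dB (u - v) e e0.
have : rdot (u - v) (u - v) = rdot (u - v) (u - v - w).
  by rewrite [RHS]rdotBr (rdotBl u v w) h // subrr subr0.
rewrite rdotE => h2; have := cauchy_schwarz (u - v) (u - v - w); rewrite -h2 expr2.
have := nm_ge0 (u - v); rewrite le0r => /orP[/eqP -> _|c0]; first exact: ltW.
by rewrite ler_pM2l // => /le_trans; apply; exact: ltW.
Qed.

Lemma nm_sub_sqr H (u v : H) :
  nm (u - v) ^+ 2 = nm u ^+ 2 + nm v ^+ 2 - 2 * rdot u v.
Proof. by rewrite -!rdotE rdotBl !rdotBr (rdotC v u); ring. Qed.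

End Inner.

(** * Bounded operators, extension and adjoints *)
Section Operators.
Context {R : realType}.
Implicit Types V W X : normedModType R[i].
Implicit Types H L : hilbertType R[i].

(** Boundedness with an explicit constant, also between different spaces; on a
    single space it agrees with continuity, by [bounded_opP]. *)
Definition bop V W (T : V -> W) :=
  linear T /\ exists2 C : R, 0 <= C & forall v, nm (T v) <= C * nm v.

Section Lin.
Variables (V W : lmodType R[i]) (T : V -> W).
Hypothesis lT : linear T.

Lemma linD u v : T (u + v) = T u + T v.
Proof. by have := lT 1 u v; rewrite !scale1r. Qed.

Lemma lin0 : T 0 = 0.
Proof. by apply: (@addrI _ (T 0)); rewrite -linD !addr0. Qed.

Lemma linZ c v : T (c *: v) = c *: T v.
Proof. by have := lT c v 0; rewrite !addr0 lin0 addr0. Qed.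

Lemma linB u v : T (u - v) = T u - T v.
Proof. by rewrite addrC -scaleN1r lT scaleN1r addrC. Qed.

End Lin.

Lemma bounded_opP H (T : H -> H) : bounded_op T <-> bop T.
Proof.
split=> -[lT hT]; split=> //.
  have : nbhs (0 : H) (T @^-1` [set w | nm (T 0 - w) < 1]).
    by apply: hT; apply/nbhs_nmP; exists 1.
  rewrite (lin0 lT) => /nbhs_nmP[e e0 he].
  have he' v : nm v < e -> nm (T v) < 1.
    by move=> ve; rewrite -nmN -sub0r; apply: he; rewrite sub0r nmN.
  exists (2 / e) => [|v]; first by rewrite divr_ge0 // ltW.
  case: (eqVneq (nm v) 0) => [/nm_eq0 ->|v0].
    by rewrite (lin0 lT) !nm0 mulr0.
  have {}v0 : 0 < nm v by rewrite lt_neqAle eq_sym v0 nm_ge0.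
  set r := e / 2 / nm v.
  have r0 : 0 < r by rewrite !divr_gt0.
  have := he' (r%:C *: v).
  rewrite (linZ lT) !nmZ nmRC; last exact: ltW.
  have -> : r * nm v = e / 2 by rewrite /r mulfVK // gt_eqF.
  move=> /(_ ltac:(lra)) h.
  have -> : 2 / e * nm v = r^-1 by rewrite /r; field; rewrite !gt_eqF.
  by rewrite -[leRHS]mulr1 mulrC ler_pdivlMr // mulrC ltW.
case: hT => C C0 hC v; apply/cvgrPdist_le => e e0.
have eR : e = (complex.Re e)%:C by rewrite RRe_real // ger0_real // ltW.
have r0 : 0 < complex.Re e by rewrite -ltcR -eR.
set r := complex.Re e in eR r0.
apply/nbhs_nmP; exists (r / (C + 1)); first by rewrite divr_gt0 // ltr_wpDl.
move=> u /= uv; rewrite -(linB lT) nmE eR lecR (le_trans (hC _)) //.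
rewrite -[leRHS](@mulfVK _ (C + 1)) ?gt_eqF // ?ltr_wpDl // mulrC.
by apply: ler_pM; rewrite ?nm_ge0 // ?lerDl // ltW.
Qed.

Lemma bop_comp V W X (S : W -> X) (T : V -> W) :
  bop S -> bop T -> bop (S \o T).
Proof.
move=> [lS [C C0 hC]] [lT [D D0 hD]]; split.
  by move=> c u v /=; rewrite lT lS.
exists (C * D); first by rewrite mulr_ge0.
by move=> v /=; rewrite (le_trans (hC _)) // -mulrA ler_wpM2l.
Qed.

Lemma bop_isometry H L (T : H -> L) :
  linear T -> (forall u v, dotp (T u) (T v) = dotp u v) -> bop T.
Proof.
move=> lT hT; split => //; exists 1 => // v; rewrite mul1r.
by rewrite -(@ler_pXn2r _ 2) ?nnegrE ?nm_ge0 // -!rdotE /rdot hT.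
Qed.

Lemma bop_id (V : normedModType R[i]) : bop (@id V).
Proof. by split=> //; exists 1 => // v; rewrite mul1r. Qed.

Lemma bop_iter (V : normedModType R[i]) (T : V -> V) m : bop T -> bop (iter m T).
Proof.
move=> bT; elim: m => [|m ih]; first exact: bop_id.
exact: (bop_comp bT ih).
Qed.

Lemma bop_eq_dense V W (B : set V) (S T : V -> W) : bop S -> bop T ->
  (forall v e, 0 < e -> exists2 u, B u & nm (v - u) < e) ->
  (forall v, B v -> S v = T v) -> S = T.
Proof.
move=> [lS [C C0 hC]] [lT [D D0 hD]] dB ST; apply/funext => v.
apply/subr0_eq/nm_arbitrarily_small => e e0.
have d0 : 0 < C + D + 1 by lra.
have [u Bu vu] := dB v (e / (C + D + 1)) ltac:(exact: divr_gt0).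
apply: le_trans (nm_triangle (S u) _ _) _.
rewrite {2}(ST _ Bu) -(linB lS) -(linB lT).
have := hC (v - u); have := hD (u - v); rewrite (nmB u) => h1 h2.
apply: le_trans (lerD h2 h1) _.
rewrite -mulrDl; apply: le_trans (_ : (C + D + 1) * nm (v - u) <= _).
  by rewrite ler_wpM2r ?nm_ge0 //; lra.
by rewrite mulrC -ler_pdivlMr // ltW.
Qed.

(** Extension by continuity. The operator is given by its graph rather than by
    a function on its domain, so that no representatives have to be chosen when
    it is defined by a formula such as [pi x xi |-> pi (f x) xi]; the bound makes
    the relation functional. *)
Lemma dense_relation_extends V (W : completeNormedModType R[i])
    (rel : V -> W -> Prop) (C : R) :
  0 <= C ->
  (forall c v w v' w', rel v w -> rel v' w' -> rel (c *: v + v') (c *: w + w')) ->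
  (forall v w, rel v w -> nm w <= C * nm v) ->
  (forall v (e : R), 0 < e -> exists v' w', rel v' w' /\ nm (v - v') < e) ->
  exists T : V -> W, [/\ linear T, forall v, nm (T v) <= C * nm v &
    forall v w, rel v w -> T v = w].
Proof.
move=> C0 rlin rbd rdense.
have rsub v w v' w' : rel v w -> rel v' w' -> nm (w - w') <= C * nm (v - v').
  move=> r1 r2; apply: rbd.
  by have := rlin (-1) _ _ _ _ r2 r1; rewrite !scaleN1r !(addrC (- _)).
have small (k e : R) : 0 <= k -> 0 < e -> exists2 d : R, 0 < d & k * d <= e.
  move=> k0 e0; exists (e / (k + 1)); first by rewrite divr_gt0 //; lra.
  by rewrite mulrCA ger_pMr // ler_pdivrMr; lra.
(* The value at [v] is characterised by being at distance at most
   [C * nm (v - v')] from each [w'] related to a [v']. *)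
have ex v : exists t : W, forall v' w', rel v' w' -> nm (w' - t) <= C * nm (v - v').
  pose P e := [set w | exists2 v', rel v' w & C * nm (v - v') <= e].
  have [e e0|e d x y e0 d0 [v1 r1 h1] [v2 r2 h2]|t ht] := @approximants_converge _ _ P.
  - have [d d0 de] := small C e C0 e0.
    have [v' [w' [r v'd]]] := rdense v d d0.
    exists w', v' => //; apply: le_trans de.
    by rewrite ler_wpM2l // ltW.
  - apply: le_trans (rsub _ _ _ _ r1 r2) _; apply: le_trans (lerD h1 h2).
    by rewrite -mulrDr ler_wpM2l // (nmB v v1) nm_triangle.
  exists t => v' w' r; apply/ler_addgt0Pr => e e0; apply: ht.
    by rewrite ltr_wpDl // mulr_ge0 // nm_ge0.
  by exists v' => //; rewrite lerDl ltW.
have [T hT] := choice ex.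
exists T; split=> [c u v|v|v w r].
- apply/subr0_eq/nm_arbitrarily_small => e e0.
  have k0 : 0 <= 2 * C * (nm c + 1) by rewrite !mulr_ge0 // addr_ge0 // nm_ge0.
  have [d d0 de] := small _ e k0 e0.
  have [u' [wu [ru ud]]] := rdense u d d0.
  have [v' [wv [rv vd]]] := rdense v d d0.
  have := hT (c *: u + v) _ _ (rlin c _ _ _ _ ru rv).
  have := hT u _ _ ru; have := hT v _ _ rv => hv hu huv.
  have e1 : c *: u + v - (c *: u' + v') = c *: (u - u') + (v - v').
    by rewrite scalerBr opprD addrACA.
  have e2 : c *: wu + wv - (c *: T u + T v) = c *: (wu - T u) + (wv - T v).
    by rewrite scalerBr opprD addrACA.
  apply: le_trans (nm_triangle (c *: wu + wv) _ _) _.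
  rewrite (nmB (T _)) e2; apply: le_trans de.
  have a1 : nm (c *: (wu - T u) + (wv - T v)) <= nm c * (C * d) + C * d.
    apply: le_trans (nmD _ _) _; rewrite nmZ lerD //.
      rewrite ler_wpM2l ?nm_ge0 // (le_trans hu) // ler_wpM2l //; exact: ltW.
    rewrite (le_trans hv) // ler_wpM2l //; exact: ltW.
  have a2 : nm (c *: u + v - (c *: u' + v')) <= nm c * d + d.
    rewrite e1; apply: le_trans (nmD _ _) _; rewrite nmZ lerD //; last exact: ltW.
    rewrite ler_wpM2l ?nm_ge0 //; exact: ltW.
  have a3 : C * nm (c *: u + v - (c *: u' + v')) <= C * (nm c * d + d).
    by rewrite ler_wpM2l.
  have a4 : 2 * C * (nm c + 1) * d = C * (nm c * d + d) + (nm c * (C * d) + C * d).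
    by ring.
  by rewrite a4; apply: lerD => //; exact: le_trans huv _.
- apply/ler_addgt0Pr => e e0.
  have k0 : 0 <= 2 * C by rewrite mulr_ge0.
  have [d d0 de] := small _ e k0 e0.
  have [v' [w' [r vd]]] := rdense v d d0.
  have h := hT v _ _ r; have h' := rbd _ _ r.
  have t1 : nm (T v) <= nm (T v - w') + nm w'.
    by have := nmD (T v - w') w'; rewrite subrK.
  have t2 : nm v' <= nm v + nm (v - v').
    by have := nmD v (v' - v); rewrite (nmB v') addrC subrK.
  rewrite nmB in t1.
  have t3 : C * nm v' <= C * (nm v + nm (v - v')) by rewrite ler_wpM2l.
  have t4 : C * nm (v - v') <= C * d by rewrite ler_wpM2l // ltW.
  lra.
have := hT v _ _ r; rewrite subrr nm0 mulr0 => h.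
by apply/esym/subr0_eq/nm_eq0/le_anti; rewrite h nm_ge0.
Qed.

(** The representing vector minimises the functional
    [J v = |v|^2 - 2 Re (f v)]: by the parallelogram identity the approximate
    minimisers get close to each other, and the derivative of [J] vanishes at
    the limit. *)
Lemma riesz H (f : H -> R[i]) (C : R) : 0 <= C -> scalar f ->
  (forall v, nm (f v) <= C * nm v) -> exists w, forall v, f v = dotp v w.
Proof.
move=> C0 lf hf.
have ReZ (r : R) (a : R[i]) : complex.Re (r%:C * a) = r * complex.Re a.
  by case: a => x y /=; rewrite mul0r subr0.
have f0 : f 0 = 0.
  have := lf 1 0 0; rewrite scale1r addr0 mul1r => /eqP.
  by rewrite -subr_eq subrr => /eqP.
pose g v := complex.Re (f v).
have gl (r : R) u v : g (r%:C *: u + v) = r * g u + g v.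
  by rewrite /g lf ReD ReZ.
pose J v := nm v ^+ 2 - 2 * g v.
have J_ge v : - C ^+ 2 <= J v.
  have h1 : g v <= C * nm v by apply: le_trans (hf v); exact: Re_le_nm.
  have h2 := sqr_ge0 (nm v - C); rewrite /J; nra.
have hinf : has_inf (range J).
  split; first by exists (J 0), 0.
  by exists (- C ^+ 2) => _ [v _ <-].
set m := inf (range J).
have m_le v : m <= J v by apply: ge_inf; [case: hinf|exists v].
have para u v : nm (u - v) ^+ 2 =
    2 * J u + 2 * J v - 4 * J ((2^-1)%:C *: u + (2^-1)%:C *: v).
  have g2 : g ((2^-1)%:C *: u + (2^-1)%:C *: v) = 2^-1 * g u + 2^-1 * g v.
    have := gl (2^-1) v 0; rewrite addr0 => h0.
    by rewrite gl h0 {3}/g f0 addr0.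
  rewrite /J g2 -!rdotE rdotBl !rdotBr rdotDl !rdotDr !rdotZl !rdotZr (rdotC v u).
  by field.
pose P e := [set v | J v <= m + e ^+ 2 / 2].
have [e e0|e d x y e0 d0 Px Py|w hw] := @approximants_converge _ H P.
- have e20 : 0 < e ^+ 2 / 2 by rewrite divr_gt0 // exprn_gt0.
  have [_ [v _ <-] hv] := inf_adherent e20 hinf.
  by exists v; exact: ltW.
- rewrite -(@ler_pXn2r _ 2) ?nnegrE ?nm_ge0 // ?addr_ge0 ?ltW //.
  rewrite para; have := m_le ((2^-1)%:C *: x + (2^-1)%:C *: y).
  by move: Px Py; rewrite /P/=; nra.
(* First variation: compare the values of [J] at an approximate minimiser [x]
   of precision [e] and at [x + e u], [x - e u]. *)
have key u e : 0 < e -> 2 * `|rdot u w - g u| <= e * (nm u ^+ 2 + 2 * nm u + 2^-1).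
  move=> e0.
  have e20 : 0 < e ^+ 2 / 2 by rewrite divr_gt0 // exprn_gt0.
  have [_ [x _ <-] /ltW hx] := inf_adherent e20 hinf.
  have xw := hw e x e0 hx.
  have Jx t : J (t%:C *: u + x) = J x + t ^+ 2 * nm u ^+ 2 + 2 * t * (rdot u x - g u).
    by rewrite /J gl -!rdotE rdotDl !rdotDr !rdotZl !rdotZr (rdotC x u); ring.
  have c1 : rdot u (x - w) <= nm u * e.
    by apply: le_trans (cauchy_schwarz _ _) _; rewrite ler_wpM2l ?nm_ge0.
  have c2 : - rdot u (x - w) <= nm u * e.
    rewrite -rdotNr; apply: le_trans (cauchy_schwarz _ _) _.
    by rewrite nmN ler_wpM2l ?nm_ge0.
  rewrite rdotBr in c1 c2.
  have := m_le (e%:C *: u + x); have := m_le ((- e)%:C *: u + x).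
  rewrite !Jx => h1 h2.
  have {h1} h1 : e * (2 * (rdot u w - g u)) <= e * (e * (nm u ^+ 2 + 2 * nm u + 2^-1)).
    move: h1 hx; rewrite -/m => h1 hx; rewrite sqrrN in h1.
    have : e * (rdot u w - rdot u x) <= e * (nm u * e) by rewrite ler_pM2l //; lra.
    lra.
  have {h2} h2 : e * (2 * - (rdot u w - g u)) <=
      e * (e * (nm u ^+ 2 + 2 * nm u + 2^-1)).
    move: h2 hx; rewrite -/m => h2 hx.
    have : e * (rdot u x - rdot u w) <= e * (nm u * e) by rewrite ler_pM2l //; lra.
    lra.
  rewrite ler_pM2l // in h1; rewrite ler_pM2l // in h2.
  by case: (ger0P (rdot u w - g u)).
have gw u : g u = rdot u w.
  apply/esym/subr0_eq/eqP; rewrite -normr_eq0 eq_le normr_ge0 andbT.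
  set k := nm u ^+ 2 + 2 * nm u + 2^-1.
  have k0 : 0 < k by have := nm_ge0 u; have := sqr_ge0 (nm u); rewrite /k; lra.
  apply/ler_addgt0Pr => e e0; rewrite add0r.
  have ek : 0 < e / k by rewrite divr_gt0.
  have := key u _ ek; rewrite -/k mulfVK ?gt_eqF //.
  by have := normr_ge0 (rdot u w - g u); lra.
exists w => v; rewrite dotp_rdot -!gw /g.
have -> : f (- 'i *: v) = - 'i * f v.
  by have := lf (- 'i) v 0; rewrite !addr0 f0 addr0.
case: (f v) => a b /=; congr Complex; rewrite oppr0; ring.
Qed.

(** For linear operators, taking real parts loses nothing ([adjoint_ofP]),
    because [Re] of a complex linear form determines the form. *)
Definition adjp H L (T : H -> L) (S : L -> H) :=
  forall u v, rdot (T u) v = rdot u (S v).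

Lemma adjpC H L (T : H -> L) (S : L -> H) : adjp T S -> adjp S T.
Proof. by move=> h u v; rewrite rdotC -h rdotC. Qed.

Lemma adjoint_ofP H (T S : H -> H) : linear T -> (adjoint_of T S <-> adjp T S).
Proof.
move=> lT; split=> h u v; first by rewrite /rdot h.
by rewrite !dotp_rdot h -(linZ lT) h.
Qed.

Lemma adjp_bound H L (T : H -> L) (S : L -> H) (C : R) : adjp T S -> 0 <= C ->
  (forall u, nm (T u) <= C * nm u) -> forall v, nm (S v) <= C * nm v.
Proof.
move=> TS C0 hC v.
have := nm_ge0 (S v); rewrite le0r => /orP[/eqP -> |s0].
  by rewrite mulr_ge0 // nm_ge0.
rewrite -(ler_pM2l s0) -expr2 -rdotE -TS (le_trans (cauchy_schwarz _ _)) //.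
by apply: le_trans (ler_wpM2r (nm_ge0 _) (hC _)) _; rewrite mulrCA mulrA.
Qed.

(** [S v] represents the functional [u |-> dotp (T u) v]. *)
Lemma adjoint_exists H L (T : H -> L) : bop T ->
  exists2 S : L -> H, bop S & adjp T S.
Proof.
move=> [lT [C C0 hC]].
have ex v : exists w, forall u, dotp (T u) v = dotp u w.
  apply: (@riesz _ _ (C * nm v)); first by rewrite mulr_ge0 // nm_ge0.
    by move=> c x y; rewrite lT dotpPl.
  move=> u.
  have h : 0 <= nm (dotp (T u) v) by exact: nm_ge0.
  set a := dotp (T u) v in h *.
  case: (eqVneq (nm a) 0) => [->|a0].
    by rewrite !mulr_ge0 // nm_ge0.
  have {}a0 : 0 < nm a by rewrite lt_neqAle eq_sym a0.
  rewrite -(ler_pM2l a0).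
  (* Multiplying [u] by the conjugate of [a] makes the inner product real. *)
  have -> : nm a * nm a = rdot (T (a^* *: u)) v.
    have e1 : (nm a * nm a)%:C = a * a^*.
      by rewrite -sqr_normc nmE -rmorphXn.
    by rewrite /rdot (linZ lT) dotpZl -/a (mulrC a^*) -e1.
  apply: le_trans (cauchy_schwarz _ _) _.
  have := hC (a^* *: u); rewrite nmZ.
  have -> : nm (a^*) = nm a by rewrite /nm normcJ.
  move=> h'; apply: le_trans (ler_wpM2r (nm_ge0 _) h') _.
  by rewrite le_eqVlt; apply/orP; left; apply/eqP; ring.
have [S hS] := choice ex.
have aS : adjp T S by move=> u v; rewrite /rdot hS.
exists S => //; split.
  move=> c u v; apply: rdot_eq => w; rewrite ![rdot _ w]rdotC -aS.
  have := hS v w; have := hS u w => e1 e2.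
  by rewrite /rdot !dotpPr e1 e2.
by exists C => //; exact: adjp_bound aS C0 hC.
Qed.

Lemma isometry_adjK H L (T : H -> L) (S : L -> H) :
  (forall u v, dotp (T u) (T v) = dotp u v) -> adjp T S -> cancel T S.
Proof.
by move=> hT hS u; apply: rdot_eq => w; rewrite rdotC -hS /rdot hT -/(rdot w u) rdotC.
Qed.

Lemma isometry_inj H L (T : H -> L) :
  linear T -> (forall u v, dotp (T u) (T v) = dotp u v) -> injective T.
Proof.
move=> lT hT u v e; apply/subr0_eq/nm_eq0/eqP.
by rewrite -sqrf_eq0 -rdotE /rdot -hT (linB lT) e subrr -/(rdot _ _) rdotE nm0 expr0n.
Qed.

Lemma isometry_nm (H L : hilbertType R[i]) (T : H -> L) :
  (forall u v, rdot (T u) (T v) = rdot u v) -> forall u, nm (T u) = nm u.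
Proof.
move=> h u; apply/eqP.
by rewrite -(@eqrXn2 _ 2) ?nm_ge0 // -!rdotE h.
Qed.

End Operators.

(** * Contractivity of representations *)
Lemma iter_can (T : Type) (f g : T -> T) m : cancel f g -> cancel (iter m f) (iter m g).
Proof. by move=> fK; elim: m => // m ih v; rewrite iterSr /= fK ih. Qed.

Lemma commutes_iter (X : Type) (T S : X -> X) m v : T \o S = S \o T ->
  T (iter m S v) = iter m S (T v).
Proof.
move=> TS; elim: m => //= m ih.
by have /(congr1 (@^~ (iter m S v))) /= -> := TS; rewrite ih.
Qed.

Lemma expn_small {R : realType} (q k : R) :
  0 <= q < 1 -> 0 < k -> exists n, q ^+ n <= k.
Proof.
move=> /andP[q0 q1] k0.
have : (fun n => q ^+ n) @ \oo --> (0 : R).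
  by apply: cvg_expr; rewrite ger0_norm.
move=> /cvgrPdist_le /(_ k k0) [n _ /(_ n (leqnn n))] /=.
by rewrite sub0r normrN ger0_norm ?exprn_ge0 // => h; exists n.
Qed.

Section Representations.
Context {R : realType}.
Implicit Types H L : hilbertType R[i].

Section CStarNorm.
Variable A : cstarAlgType R[i].
Implicit Types x y : A.

Lemma nm_cmul x y : nm (cmul x y) <= nm x * nm y.
Proof. by rewrite -lecR rmorphM/= -!nmE cmul_norm. Qed.

Lemma nm_cstar x : nm (cmul (star x) x) = nm x ^+ 2.
Proof. by apply: complexI; rewrite rmorphXn/= -!nmE cstar_norm. Qed.

Lemma nm_star x : nm (star x) = nm x.
Proof.
have h y : nm y <= nm (star y).
  have := nm_cmul (star y) y; rewrite nm_cstar expr2.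
  have := nm_ge0 y; rewrite le0r => /orP[/eqP -> _|y0]; first exact: nm_ge0.
  by rewrite ler_pM2r.
by have := h (star x); rewrite starK => h2; apply/le_anti; rewrite h2 h.
Qed.

Lemma starB x y : star (x - y) = star x - star y.
Proof.
by rewrite -scaleN1r starD starZ rmorphN rmorph1 scaleN1r.
Qed.

Lemma star1 : star (cone : A) = cone.
Proof. by rewrite -[LHS]cmul1x -[X in cmul X _]starK -starM cmul1x starK. Qed.

(** Right multiplication by [1 - a] is bounded below by [1 - |a|], so the points
    that it sends near [1] are close to each other; the partial sums of the
    geometric series are such points. *)
Lemma neumann_left_inverse (a : A) : nm a < 1 -> exists b, cmul b (cone - a) = cone.
Proof.
move=> a1; have a0 := nm_ge0 a.
have a10 : 0 < 1 - nm a by lra.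
pose d x := x - cmul x a.
have lmul : linear (cmul^~ a : A -> A) by exact: cmul_linearl.
have ld : linear d by move=> c x y; rewrite /d lmul scalerBr opprD addrACA.
have d_ge x : nm x * (1 - nm a) <= nm (d x).
  have h1 := nm_cmul x a; have h2 := nmD (d x) (cmul x a).
  by move: h2; rewrite /d subrK; lra.
have resid n : exists x, cone - d x = iter n (cmul^~ a) cone.
  elim: n => [|n [x e]].
    by exists 0; rewrite /d (lin0 lmul) !subr0.
  exists (x + iter n (cmul^~ a) cone).
  by rewrite (linD ld) opprD addrA e /d opprB addrC subrK.
pose P e := [set x | nm (cone - d x) <= e * (1 - nm a)].
have P0 e : 0 < e -> P e !=set0.
  move=> e0.
  have k0 : 0 < e * (1 - nm a) / (nm (cone : A) + 1).
    by rewrite divr_gt0 ?mulr_gt0 // ltr_wpDl // nm_ge0.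
  have [|n hn] := @expn_small R (nm a) _ _ k0; first by rewrite a0.
  have [x hx] := resid n; exists x; rewrite /P/= hx.
  have : nm (iter n (cmul^~ a) cone : A) <= nm a ^+ n * nm (cone : A).
    elim: n {hn hx} => [|n ih] /=; first by rewrite expr0 mul1r.
    rewrite exprSr mulrAC (le_trans (nm_cmul _ _)) // ler_wpM2r //.
  have := nm_ge0 (cone : A) => c0 h.
  rewrite (le_trans h) //; move: hn; rewrite ler_pdivlMr ?ltr_wpDl // mulrDr.
  by have := exprn_ge0 n a0; lra.
have [|e f x y e0 f0 Px Py|w hw] := @approximants_converge _ A P.
- exact: P0.
- rewrite -(ler_pM2r a10) (le_trans (d_ge _)) // (linB ld).
  have := nm_triangle cone (d x) (d y); rewrite (nmB (d x) cone).
  by move: Px Py; rewrite /P/=; lra.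
exists w; rewrite (linB (cmul_linearr w)) cmulx1 -/(d w).
apply/esym/subr0_eq/nm_arbitrarily_small => e e0.
have k0 : 0 < e / 4 by lra.
have [x Px] : P (e / 4) !=set0 by exact: P0.
have xw := hw _ _ k0 Px.
apply: le_trans (nm_triangle (d x) _ _) _; rewrite -(linB ld).
have h1 : nm (d (x - w)) <= nm (x - w) + nm a * nm (x - w).
  rewrite /d; apply: le_trans (nmD _ _) _; rewrite nmN lerD2l mulrC; exact: nm_cmul.
have h2 : nm a * nm (x - w) <= nm (x - w) by rewrite ler_piMl ?nm_ge0 // ltW.
have h3 : e / 4 * (1 - nm a) <= e / 4 by nra.
by move: Px; rewrite /P/=; lra.
Qed.

End CStarNorm.

Record star_rep (A : cstarAlgType R[i]) (H : hilbertType R[i])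
    (rho : A -> H -> H) := StarRep {
  rep_bop : forall a : A, bop (rho a);
  rep_linear : forall c (a b : A) v, rho (c *: a + b) v = c *: rho a v + rho b v;
  rep1 : rho cone = id;
  repM : forall a b : A, rho (cmul a b) = rho a \o rho b;
  rep_adj : forall a : A, adjp (rho a) (rho (star a))
}.

(** Let [M] be the norm of [rho a], and suppose that [|a| < M]. Then
    [M^2 - a^* a] is invertible by the Neumann series, hence [M^2 - rho (a^* a)]
    is bounded below. But it sends unit vectors on which [rho a] almost attains
    its norm to vectors of norm close to zero. *)
Lemma rep_contractive (A : cstarAlgType R[i]) (H : hilbertType R[i])
    (rho : A -> H -> H) : star_rep rho ->
  forall (a : A) v, nm (rho a v) <= nm a * nm v.
Proof.
move=> [bnd rlin r1 rM radj] a.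
pose E := [set C : R | 0 <= C /\ forall v, nm (rho a v) <= C * nm v].
have hinf : has_inf E.
  split; last by exists 0 => C [].
  by have [_ [C C0 hC]] := bnd a; exists C.
set M := inf E.
have M0 : 0 <= M by apply: lb_le_inf; [case: hinf|move=> C []].
have hM v : nm (rho a v) <= M * nm v.
  apply/ler_addgt0Pr => e e0.
  have k0 : 0 < e / (nm v + 1) by rewrite divr_gt0 // ltr_wpDl // nm_ge0.
  have [C [C0 hC] CM] := inf_adherent k0 hinf.
  apply: le_trans (hC v) _; apply: le_trans (ler_wpM2r (nm_ge0 v) (ltW CM)) _.
  rewrite mulrDl lerD2l mulrAC ler_pdivrMr ?ltr_wpDl ?nm_ge0 //.
  by rewrite ler_pM2l // lerDl.
suff Ma : M <= nm a.
  by move=> v; apply: le_trans (hM v) _; rewrite ler_wpM2r // nm_ge0.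
rewrite leNgt; apply/negP => aM.
have Mp : 0 < M by apply: le_lt_trans aM; exact: nm_ge0.
have M2p : 0 < M ^+ 2 by rewrite exprn_gt0.
set h := cmul (star a) a.
have [b hb] : exists b, cmul b ((M ^+ 2)%:C *: cone - h) = cone.
  have [|b hb] := @neumann_left_inverse A (((M ^+ 2)^-1)%:C *: h).
    rewrite nmZ nmRC ?invr_ge0 ?ltW // /h nm_cstar mulrC ltr_pdivrMr // mul1r.
    by rewrite ltr_pXn2r // ?nnegrE ?nm_ge0.
  exists (((M ^+ 2)^-1)%:C *: b).
  rewrite -[RHS]hb.
  have lb := linZ (cmul_linearl ((M ^+ 2)%:C *: cone - h)); rewrite /= in lb.
  rewrite lb -(linZ (cmul_linearr b)); congr (cmul b _).
  by rewrite scalerBr scalerA -rmorphM /= mulVf ?gt_eqF // scale1r.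
have adj_bd := adjp_bound (radj a) M0 hM.
have [_ [D0 D00 hD0]] := bnd b.
pose D := D0 + 1.
have Dp : 0 < D by rewrite ltr_wpDl.
have hD v : nm v <= D * nm ((M ^+ 2)%:C *: v - rho h v).
  have -> : (M ^+ 2)%:C *: v - rho h v = rho ((M ^+ 2)%:C *: cone - h) v.
    have lr : linear (rho^~ v) by move=> c x y; exact: rlin.
    by rewrite (linB lr) (linZ lr) r1.
  have {1}-> : v = rho b (rho ((M ^+ 2)%:C *: cone - h) v).
    by have := rM b ((M ^+ 2)%:C *: cone - h); rewrite hb r1 => /(congr1 (@^~ v)).
  by apply: le_trans (hD0 _) _; rewrite ler_wpM2r ?nm_ge0 // /D lerDl.
(* Being bounded below by [1 / D] improves the bound [M ^+ 2] of the squared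
   norm to [k]; when [k] is negative, [Num.sqrt k] is [0] and so is [rho a]. *)
pose k := M ^+ 2 - (D ^+ 2 * M ^+ 2)^-1.
have kM : Num.sqrt k < M.
  rewrite -[ltRHS]ger0_norm // -sqrtr_sqr ltr_sqrt // /k ltrBlDr ltrDl.
  by rewrite invr_gt0 mulr_gt0 // exprn_gt0.
have : M <= Num.sqrt k; last by rewrite leNgt kM.
apply: ge_inf; first by case: hinf.
split=> [|v]; first exact: sqrtr_ge0.
have hk : nm (rho a v) ^+ 2 <= k * nm v ^+ 2.
  have h1 : nm v ^+ 2 <= D ^+ 2 * nm ((M ^+ 2)%:C *: v - rho h v) ^+ 2.
    rewrite -exprMn ler_pXn2r // ?nnegrE ?nm_ge0 //.
    by rewrite mulr_ge0 ?nm_ge0 // ltW.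
  have rh : rho h v = rho (star a) (rho a v) by rewrite /h rM.
  have h2 : nm ((M ^+ 2)%:C *: v - rho h v) ^+ 2 <=
      M ^+ 2 * (M ^+ 2 * nm v ^+ 2 - nm (rho a v) ^+ 2).
    rewrite nm_sub_sqr nmZ (nmRC (ltW M2p)) rdotZl rh.
    rewrite -(radj a) rdotE.
    have : nm (rho (star a) (rho a v)) ^+ 2 <= M ^+ 2 * nm (rho a v) ^+ 2.
      by rewrite -exprMn ler_pXn2r // ?nnegrE ?mulr_ge0 ?nm_ge0.
    by rewrite exprMn; lra.
  have D2p : 0 < D ^+ 2 by rewrite exprn_gt0.
  have h3 : nm v ^+ 2 <= (D ^+ 2 * M ^+ 2) * (M ^+ 2 * nm v ^+ 2 - nm (rho a v) ^+ 2).
    by apply: le_trans h1 _; rewrite -mulrA ler_pM2l.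
  have DM : 0 < D ^+ 2 * M ^+ 2 by rewrite mulr_gt0.
  have h4 : (D ^+ 2 * M ^+ 2)^-1 * nm v ^+ 2 <= M ^+ 2 * nm v ^+ 2 - nm (rho a v) ^+ 2.
    by rewrite mulrC ler_pdivrMr // mulrC.
  by rewrite /k mulrBl; lra.
have [k0|k0] := leP 0 k.
  rewrite -(@ler_pXn2r _ 2) ?nnegrE ?nm_ge0 ?mulr_ge0 ?sqrtr_ge0 ?nm_ge0 //.
  by rewrite exprMn sqr_sqrtr.
rewrite (_ : nm (rho a v) = 0) ?mulr_ge0 ?sqrtr_ge0 ?nm_ge0 //.
apply/eqP; rewrite -sqrf_eq0 eq_le sqr_ge0 andbT (le_trans hk) //.
by rewrite mulr_le0_ge0 ?sqr_ge0 // ltW.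
Qed.

End Representations.

(** * Commutants *)
Section Commutants.
Context {R : realType}.
Implicit Types H L : hilbertType R[i].

Definition adj_closed H (S : set (H -> H)) :=
  forall X, S X -> exists2 Y, S Y & adjp X Y.

(** Taking adjoints in [T Y = Y T], with [Y] the adjoint of [X], gives
    [T' X = X T']. *)
Lemma commutant_adj H (S : set (H -> H)) (T T' : H -> H) : adj_closed S ->
  commutant S T -> adjp T T' -> bop T' -> commutant S T'.
Proof.
move=> cS [bT hT] TT' bT'; split; first exact/bounded_opP.
move=> X SX; have [Y SY XY] := cS _ SX; apply/funext => v; apply: rdot_eq => w /=.
rewrite rdotC -TT' rdotC XY rdotC; have /(congr1 (@^~ w)) /= <- := hT _ SY.
by rewrite TT' rdotC -XY.
Qed.

Lemma commutant_adj_closed H (S : set (H -> H)) :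
  adj_closed S -> adj_closed (commutant S).
Proof.
move=> cS T [/bounded_opP bT hT]; have [T' bT' TT'] := adjoint_exists bT.
by exists T' => //; apply: commutant_adj TT' bT' => //; split => //; apply/bounded_opP.
Qed.

Lemma commutant_bop H (S : set (H -> H)) T : commutant S T -> bop T.
Proof. by case=> /bounded_opP. Qed.

Lemma commutant_comm H (S : set (H -> H)) T X : commutant S T -> S X ->
  forall v, T (X v) = X (T v).
Proof. by move=> [_ h] SX v; have /(congr1 (@^~ v)) := h _ SX. Qed.

Lemma commutantI H (S : set (H -> H)) T : bop T ->
  (forall X, S X -> forall v, T (X v) = X (T v)) -> commutant S T.
Proof.
move=> bT h; split; first exact/bounded_opP.
by move=> X SX; apply/funext => v /=; exact: h.
Qed.

Lemma commutant_comp H (S : set (H -> H)) T U :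
  commutant S T -> commutant S U -> commutant S (T \o U).
Proof.
move=> cT cU; apply: commutantI;
  first exact: bop_comp (commutant_bop cT) (commutant_bop cU).
by move=> X SX v /=; rewrite (commutant_comm cU SX) (commutant_comm cT SX).
Qed.

Lemma bicommutant_lin H (S : set (H -> H)) c T U : bicommutant S T ->
  bicommutant S U -> bicommutant S (c \*: T \+ U).
Proof.
move=> cT cU; apply: commutantI => [|X SX v /=]; last first.
  have [lX _] := commutant_bop SX.
  by rewrite lX (commutant_comm cT SX) (commutant_comm cU SX).
have [lT [C C0 hC]] := commutant_bop cT; have [lU [D D0 hD]] := commutant_bop cU.
split=> [k u v /=|]; first by rewrite lT lU !scalerDr !scalerA (mulrC c) addrACA.
exists (nm c * C + D); first by rewrite addr_ge0 // mulr_ge0 // nm_ge0.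
move=> v /=; apply: le_trans (nmD _ _) _; rewrite nmZ mulrDl lerD //.
by rewrite -mulrA ler_wpM2l ?nm_ge0.
Qed.

End Commutants.

(** * The algebra of words in a free product *)
Section FreeProducts.
Context {R : realType} {A : cstarAlgType R[i]}.

(** The algebraic subalgebra generated by the copies with index in [J]. It is
    dense for full [J], and every element involves finitely many indices;
    identities between the maps [fp_map] are checked on it by induction, which
    spares their continuity. *)
Inductive words (I : Type) (P : freeProduct A I) (J : set I) : P -> Prop :=
| words_emb j a : J j -> words J (fp_emb P j a)
| words_one : words J cone
| words_lin c x y : words J x -> words J y -> words J (c *: x + y)
| words_mul x y : words J x -> words J y -> words J (cmul x y).

Section One.
Variables (I : Type) (P : freeProduct A I).
Implicit Types (J : set I) (x y : P).

Lemma words_sub J J' x : J `<=` J' -> words J x -> words J' x.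
Proof.
move=> JJ'; elim=> [j a /JJ' Jj||c u v _ hu _ hv|u v _ hu _ hv].
- exact: words_emb.
- exact: words_one.
- exact: words_lin.
- exact: words_mul.
Qed.

Lemma words_star J x : words J x -> words J (star x).
Proof.
elim=> [j a Jj||c u v _ hu _ hv|u v _ hu _ hv].
- by have [_ _ _ <-] := fp_emb_morphism P j; exact: words_emb.
- by rewrite star1; exact: words_one.
- by rewrite starD starZ; exact: words_lin.
- by rewrite starM; exact: words_mul.
Qed.

(** Finitely many indices lie in a single member of an increasing exhaustion. *)
Lemma words_exhaust (K : nat -> set I) x :
  (forall m n, (m <= n)%N -> K m `<=` K n) -> (forall j, exists n, K n j) ->
  words setT x -> exists n, words (K n) x.
Proof.
move=> Kmono Kall; elim=> [j a _||c u v _ [m hu] _ [n hv]|u v _ [m hu] _ [n hv]].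
- by have [n Kn] := Kall j; exists n; exact: words_emb.
- by exists 0; exact: words_one.
- exists (maxn m n); apply: words_lin; [apply: words_sub hu|apply: words_sub hv];
  by apply: Kmono; rewrite ?leq_maxl ?leq_maxr.
- exists (maxn m n); apply: words_mul; [apply: words_sub hu|apply: words_sub hv];
  by apply: Kmono; rewrite ?leq_maxl ?leq_maxr.
Qed.

Lemma words_exhaust2 (K : nat -> set I) x y :
  (forall m n, (m <= n)%N -> K m `<=` K n) -> (forall j, exists n, K n j) ->
  words setT x -> words setT y -> exists n, words (K n) x /\ words (K n) y.
Proof.
move=> Kmono Kall wx wy.
have [m wxm] := words_exhaust Kmono Kall wx.
have [n wyn] := words_exhaust Kmono Kall wy.
by exists (maxn m n); split; [apply: words_sub wxm|apply: words_sub wyn];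
  apply: Kmono; rewrite ?leq_maxl ?leq_maxr.
Qed.

(** The closure of the words is a closed star-subalgebra containing the
    generators. *)
Lemma words_dense x (e : R) : 0 < e -> exists2 y, words setT y & nm (x - y) < e.
Proof.
pose D : set P := closure (words setT).
suff : D x by move=> /closureP_nm h /h.
have : cstar_generated [set x | exists j a, x = fp_emb P j a] x.
  by rewrite fp_generated.
apply; split; last first.
  by move=> _ [j [a ->]]; apply: subset_closure; exact: words_emb.
have small (k e' : R) : 0 <= k -> 0 < e' -> exists2 d : R, 0 < d & k * d < e'.
  move=> k0 e0; exists (e' / (k + 1)); first by rewrite divr_gt0 //; lra.
  by rewrite mulrCA gtr_pMr // ltr_pdivrMr; lra.
split.
- exact: closed_closure.
- by apply: subset_closure; exact: words_one.
- move=> c u v /closureP_nm Du /closureP_nm Dv; apply/closureP_nm => f f0.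
  have [|d d0 df] := small (nm c + 1) f _ f0; first by rewrite addr_ge0 ?nm_ge0.
  have [u' wu uu] := Du _ d0; have [v' wv vv] := Dv _ d0.
  exists (c *: u' + v'); first exact: words_lin.
  rewrite opprD addrACA -scalerBr; apply: le_lt_trans (nmD _ _) _.
  rewrite nmZ; apply: le_lt_trans df; rewrite mulrDl mul1r lerD //; last exact: ltW.
  by rewrite ler_wpM2l ?nm_ge0 // ltW.
- move=> u v /closureP_nm Du /closureP_nm Dv; apply/closureP_nm => f f0.
  have f20 : 0 < f / 2 by lra.
  have [d d0 df] := small (nm v) (f / 2) (nm_ge0 _) f20.
  have [u' wu uu] := Du _ d0.
  have [d' d'0 df'] := small (nm u') (f / 2) (nm_ge0 _) f20.
  have [v' wv vv] := Dv _ d'0.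
  exists (cmul u' v'); first exact: words_mul.
  apply: le_lt_trans (nm_triangle (cmul u' v) _ _) _.
  rewrite -(linB (cmul_linearl v)) -(linB (cmul_linearr u')).
  have h1 := nm_cmul (u - u') v; have h2 := nm_cmul u' (v - v').
  have h3 : nm (u - u') * nm v <= nm v * d.
    by rewrite mulrC ler_wpM2l ?nm_ge0 // ltW.
  have h4 : nm u' * nm (v - v') <= nm u' * d' by rewrite ler_wpM2l ?nm_ge0 // ltW.
  lra.
- move=> u /closureP_nm Du; apply/closureP_nm => f f0.
  have [u' wu uu] := Du _ f0; exists (star u'); first exact: words_star.
  by rewrite -starB nm_star.
Qed.

End One.

Section Maps.
Variables (I I' : Type) (P : freeProduct A I) (Q : freeProduct A I').

Lemma fp_mapP (f : I -> I') : star_morphism (fp_map P Q f) /\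
  forall j a, fp_map P Q f (fp_emb P j a) = fp_emb Q (f j) a.
Proof.
pose E := [set g : P -> Q | star_morphism g /\
    forall j a, g (fp_emb P j a) = fp_emb Q (f j) a].
suff : E (fp_map P Q f) by [].
have [g [Eg _]] := fp_universal P (fun j => fp_emb_morphism Q (f j)).
exact: (xgetPex _ (ex_intro E g Eg)).
Qed.

Lemma fp_map_emb f j a : fp_map P Q f (fp_emb P j a) = fp_emb Q (f j) a.
Proof. by have [] := fp_mapP f. Qed.

Lemma fp_map_linear f : linear (fp_map P Q f).
Proof. by have [[]] := fp_mapP f. Qed.

Lemma fp_map1 f : fp_map P Q f cone = cone.
Proof. by have [[]] := fp_mapP f. Qed.

Lemma fp_mapM f x y :
  fp_map P Q f (cmul x y) = cmul (fp_map P Q f x) (fp_map P Q f y).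
Proof. by have [[]] := fp_mapP f. Qed.

Lemma fp_map_star f x : fp_map P Q f (star x) = star (fp_map P Q f x).
Proof. by have [[]] := fp_mapP f. Qed.

Lemma fp_map_words f (J : set I) (J' : set I') x :
  (forall j, J j -> J' (f j)) -> words J x -> words J' (fp_map P Q f x).
Proof.
move=> hf; elim=> [j a Jj||c u v _ hu _ hv|u v _ hu _ hv].
- by rewrite fp_map_emb; apply: words_emb; exact: hf.
- by rewrite fp_map1; exact: words_one.
- by rewrite fp_map_linear; exact: words_lin.
- by rewrite fp_mapM; exact: words_mul.
Qed.

End Maps.

(** Only the values of [h] on the indices present in [x] matter; this allows
    index maps that are increasing or injective on [J] only. *)
Lemma fp_map_comp (I1 I2 I3 : Type) (P : freeProduct A I1) (Q : freeProduct A I2)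
    (S : freeProduct A I3) f g h (J : set I1) x :
  (forall j, J j -> g (f j) = h j) -> words J x ->
  fp_map Q S g (fp_map P Q f x) = fp_map P S h x.
Proof.
move=> hJ; elim=> [j a Jj||c u v _ hu _ hv|u v _ hu _ hv].
- by rewrite !fp_map_emb hJ.
- by rewrite !fp_map1.
- by rewrite !fp_map_linear hu hv.
- by rewrite !fp_mapM hu hv.
Qed.

Lemma fp_map_id (I : Type) (P : freeProduct A I) f (J : set I) x :
  (forall j, J j -> f j = j) -> words J x -> fp_map P P f x = x.
Proof.
move=> hJ; elim=> [j a Jj||c u v _ hu _ hv|u v _ hu _ hv].
- by rewrite !fp_map_emb hJ.
- by rewrite !fp_map1.
- by rewrite !fp_map_linear hu hv.
- by rewrite !fp_mapM hu hv.
Qed.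

Lemma fp_map_eq (I I' : Type) (P : freeProduct A I) (Q : freeProduct A I') f g
    (J : set I) x : words J x -> (forall j, J j -> f j = g j) ->
  fp_map P Q f x = fp_map P Q g x.
Proof.
move=> + fg; elim=> [j a Jj||c u v _ hu _ hv|u v _ hu _ hv].
- by rewrite !fp_map_emb fg.
- by rewrite !fp_map1.
- by rewrite !fp_map_linear hu hv.
- by rewrite !fp_mapM hu hv.
Qed.

End FreeProducts.

Arguments fp_map_comp {R A I1 I2 I3 P Q S} f g h J {x}.
Arguments fp_map_id {R A I P} f J {x}.
Arguments fp_map_eq {R A I I' P Q} f g {J x}.

(** * Operators implementing index maps *)
Section GNS.
Context {R : realType}.

Lemma gns_star_rep (A : cstarAlgType R[i]) (phi : A -> R[i]) (G : gns phi) :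
  star_rep (gns_rep G).
Proof.
split=> [a|||a b|a].
- by apply/bounded_opP; exact: gns_rep_bounded.
- exact: gns_rep_linear.
- exact: gns_rep1.
- exact: gns_repM.
- by apply/adjoint_ofP; [case: (gns_rep_bounded G a)|exact: gns_rep_star].
Qed.

Lemma gns_dot (A : cstarAlgType R[i]) (phi : A -> R[i]) (G : gns phi) x y :
  dotp (gns_rep G x (gns_vec G)) (gns_rep G y (gns_vec G)) = phi (cmul (star y) x).
Proof.
rewrite (gns_state G) gns_repM /= [RHS]dotpC.
by rewrite -gns_rep_star -dotpC.
Qed.

Section GNSFree.
Context {A : cstarAlgType R[i]} {I : Type} {P : freeProduct A I} {phi : P -> R[i]}.
Variable G : gns phi.

Definition wordvec (J : set I) : set G :=
  [set v | exists2 x, words J x & v = gns_rep G x (gns_vec G)].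

Lemma wordvec_dense v (e : R) : 0 < e -> exists2 u, wordvec setT u & nm (v - u) < e.
Proof.
move=> e0; have e20 : 0 < e / 2 by lra.
have : closure (range (gns_rep G ^~ (gns_vec G))) v by rewrite gns_cyclic.
move=> /closureP_nm /(_ _ e20) [_ [x _ <-] vx].
have k0 : 0 < e / 2 / (nm (gns_vec G) + 1) by rewrite divr_gt0 // ltr_wpDl ?nm_ge0.
have [y wy xy] := words_dense x k0.
exists (gns_rep G y (gns_vec G)); first by exists y.
apply: le_lt_trans (nm_triangle (gns_rep G x (gns_vec G)) _ _) _.
have lr : linear (gns_rep G ^~ (gns_vec G)) by move=> c a b; exact: gns_rep_linear.
rewrite -(linB lr).
have := rep_contractive (gns_star_rep G) (x - y) (gns_vec G).
have : nm (x - y) * nm (gns_vec G) <= e / 2.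
  apply: le_trans (ler_wpM2r (nm_ge0 _) (ltW xy)) _.
  rewrite mulrAC ler_pdivrMr ?ltr_wpDl ?nm_ge0 //.
  by rewrite ler_pM2l // lerDl.
lra.
Qed.

Lemma op_eq_on_words (V : normedModType R[i]) (S T : G -> V) : bop S -> bop T ->
  (forall x, words setT x ->
     S (gns_rep G x (gns_vec G)) = T (gns_rep G x (gns_vec G))) -> S = T.
Proof.
move=> bS bT h; apply: bop_eq_dense bS bT wordvec_dense _.
by move=> _ [x wx ->]; exact: h.
Qed.

(** Both sides are bounded in [v], and on [v = pi x xi] they are the image of
    [i_j a * x] under [fp_map f]. *)
Lemma implements_intertwines (f : I -> I) (W : G -> G) : bop W ->
  (forall x, words setT x ->
     W (gns_rep G x (gns_vec G)) = gns_rep G (fp_map P P f x) (gns_vec G)) ->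
  forall j a v, W (gns_rep G (fp_emb P j a) v) = gns_rep G (fp_emb P (f j) a) (W v).
Proof.
move=> bW hW j a v.
have br x : bop (gns_rep G x) by exact: rep_bop (gns_star_rep G) x.
have : W \o gns_rep G (fp_emb P j a) = gns_rep G (fp_emb P (f j) a) \o W.
  apply: op_eq_on_words; [exact: bop_comp|exact: bop_comp|].
  move=> x wx /=.
  have rM a' b' u : gns_rep G a' (gns_rep G b' u) = gns_rep G (cmul a' b') u.
    by rewrite gns_repM.
  rewrite (hW x wx) !rM hW ?fp_mapM ?fp_map_emb //.
  by apply: words_mul => //; exact: words_emb.
by move=> /(congr1 (@^~ v)).
Qed.

(** Invariance of [phi] says that [pi x xi |-> pi (fp_map f x) xi] preserves
    inner products. The map [f] need not be surjective, and neither need [W]. *)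
Lemma implementing_isometry (f : I -> I) :
  (forall x, words setT x -> phi (fp_map P P f x) = phi x) ->
  exists W : G -> G, [/\ bop W, forall u v, rdot (W u) (W v) = rdot u v &
    forall x, words setT x ->
     W (gns_rep G x (gns_vec G)) = gns_rep G (fp_map P P f x) (gns_vec G)].
Proof.
move=> hphi.
have hdot x y : words setT x -> words setT y ->
    dotp (gns_rep G (fp_map P P f x) (gns_vec G))
         (gns_rep G (fp_map P P f y) (gns_vec G))
    = dotp (gns_rep G x (gns_vec G)) (gns_rep G y (gns_vec G)).
  move=> wx wy; rewrite !gns_dot -fp_map_star -fp_mapM hphi //.
  by apply: words_mul => //; exact: words_star.
pose rel v w := exists x, [/\ words setT x, v = gns_rep G x (gns_vec G)
  & w = gns_rep G (fp_map P P f x) (gns_vec G)].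
have rbd v w : rel v w -> nm w <= 1 * nm v.
  move=> [x [wx -> ->]]; rewrite mul1r -(@ler_pXn2r _ 2) ?nnegrE ?nm_ge0 //.
  by rewrite -!rdotE /rdot hdot.
have [|v e e0|T [lT bT hT]] := dense_relation_extends ler01 _ rbd.
- move=> c _ _ _ _ [x [wx -> ->]] [y [wy -> ->]]; exists (c *: x + y).
  by rewrite fp_map_linear !gns_rep_linear; split => //; exact: words_lin.
- have [_ [x wx ->] h] := wordvec_dense v e0.
  exists (gns_rep G x (gns_vec G)), (gns_rep G (fp_map P P f x) (gns_vec G)).
  by split => //; exists x.
have bT' : bop T by split => //; exists 1.
have hTw x : words setT x ->
   T (gns_rep G x (gns_vec G)) = gns_rep G (fp_map P P f x) (gns_vec G).
  by move=> wx; apply: hT; exists x.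
have [T' bT'' TT'] := adjoint_exists bT'.
(* Inner products are preserved on a dense set only; passing through the
   adjoint propagates this to all vectors. *)
have T'T : T' \o T = id.
  apply: op_eq_on_words; [exact: bop_comp|exact: bop_id|].
  move=> x wx /=; apply: (rdot_eq_dense wordvec_dense) => _ [y wy ->].
  rewrite rdotC -TT' !hTw // rdotC /rdot hdot //.
exists T; split => //.
by move=> u v; rewrite TT'; have /(congr1 (@^~ v)) /= -> := T'T.
Qed.

End GNSFree.
End GNS.

(** * Spreadability on the integers *)
Section ShiftInvariance.
Variables (R : realType) (A : cstarAlgType R[i]).
Variables (PN : freeProduct A nat) (PZ : freeProduct A int).

Definition left_shift (n : nat) (j : int) : int := if j < n%:Z then j - 1 else j.

Section State.
Variables (phi : PN -> R[i]) (phiZ : PZ -> R[i]).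
Hypothesis hspread : spreadable phi.
Hypothesis hshift : phiZ \o fp_shift PZ = phiZ.
Hypothesis hext : phiZ \o fp_incl PN PZ = phi.

Lemma phiZ_shift_iter (k : nat) x : words setT x ->
  phiZ (fp_map PZ PZ (fun j => j + k%:Z) x) = phiZ x.
Proof.
move=> wx; elim: k => [|k ih].
  by rewrite (fp_map_id _ setT) // => j _; rewrite addr0.
rewrite -ih -[in RHS]hshift /= /fp_shift.
rewrite (fp_map_comp _ _ (fun j => j + k.+1%:Z) setT) //.
by move=> j _; rewrite -addrA -[in RHS]addn1 PoszD.
Qed.

Lemma words_int_below (x : PZ) : words setT x ->
  exists m : nat, words [set j : int | - m%:Z <= j] x.
Proof.
apply: (@words_exhaust _ _ _ _ (fun m => [set j | - m%:Z <= j])).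
  by move=> m n mn j /=; lia.
by move=> j; exists `|j|%N; rewrite /=; lia.
Qed.

(** Translating [x] by [m] and its image by [m + 1] brings both into the free
    product over the natural numbers, where they are [x'] and the image of [x']
    under the increasing map [h] that misses the single value [n + m]. *)
Lemma phiZ_left_shift (n : nat) x : words setT x ->
  phiZ (fp_map PZ PZ (left_shift n) x) = phiZ x.
Proof.
move=> wx; have [m wm] := words_int_below wx.
pose x' := fp_map PZ PN (fun j => absz (j + m%:Z)) x.
have e1 : fp_map PZ PZ (fun j => j + m%:Z) x = fp_incl PN PZ x'.
  rewrite /fp_incl (fp_map_comp _ _ (fun j => j + m%:Z) [set j : int | - m%:Z <= j]) //.
  by move=> j /=; lia.
pose h i := if (i < n + m)%N then i else i.+1.
have e2 : fp_map PZ PZ (fun j => j + m.+1%:Z) (fp_map PZ PZ (left_shift n) x)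
    = fp_incl PN PZ (fp_map PN PN h x').
  pose f j := left_shift n j + m.+1%:Z.
  pose g j := h (absz (j + m%:Z)).
  rewrite (fp_map_comp _ _ f setT) //.
  rewrite /x' (fp_map_comp _ _ g setT) // /fp_incl.
  rewrite (fp_map_comp _ _ f [set j : int | - m%:Z <= j]) //.
  move=> j /= mj; rewrite /f /g /h /left_shift.
  by case: ifPn; case: ifPn; lia.
have wgx : words setT (fp_map PZ PZ (left_shift n) x) by exact: fp_map_words wx.
rewrite -(phiZ_shift_iter m.+1 wgx) e2 -(phiZ_shift_iter m wx) e1.
have hh : cofinite_increasing h.
  split; first by move=> i j ij; rewrite /h; case: ifPn; case: ifPn; lia.
  apply: (sub_finite_set (B := [set (n + m)%N])); last exact: finite_set1.
  move=> i /= hi; apply: contrapT => /eqP ni; apply: hi.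
  case: (ltnP i (n + m)) => [lt|ge].
    by exists i => //; rewrite /h lt.
  by exists i.-1 => //; rewrite /h; case: ifPn; lia.
have /(congr1 (@^~ x')) /= := hspread hh.
by rewrite -hext.
Qed.

End State.

Section TwoSidedGNS.
Variables (phiZ : PZ -> R[i]) (GZ : gns phiZ).
Notation pi := (gns_rep GZ).
Notation xi := (gns_vec GZ).

Definition gensZ (n : nat) : set (GZ -> GZ) :=
  [set T | exists (k : int) a, n%:Z <= k /\ T = pi (fp_emb PZ k a)].

Lemma commutant_gensZ n X : bop X ->
  (forall (k : int) a v, n%:Z <= k ->
     X (pi (fp_emb PZ k a) v) = pi (fp_emb PZ k a) (X v)) ->
  commutant (gensZ n) X.
Proof.
by move=> bX h; apply: commutantI => // _ [k [a [nk ->]]] v; exact: h.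
Qed.

Lemma commutant_gensZE n X (k : int) a v : commutant (gensZ n) X -> n%:Z <= k ->
  X (pi (fp_emb PZ k a) v) = pi (fp_emb PZ k a) (X v).
Proof. by move=> cX nk; apply: (commutant_comm cX); exists k, a. Qed.

(** A star-morphism of free products is an algebraic notion, so continuity of
    the inclusion is not available a priori; contractivity is applied to the
    composite representation. *)
Lemma incl_star_rep : star_rep (fun x : PN => pi (fp_incl PN PZ x)).
Proof.
have [b l o m a] := gns_star_rep GZ; rewrite /fp_incl; split=> [x|c x y v||x y|x] //=.
- by rewrite fp_map_linear l.
- by rewrite fp_map1.
- by rewrite fp_mapM m.
- by rewrite fp_map_star; exact: a.
Qed.

(** Commutation passes from generators to words algebraically, and from words
    to their norm limits because the representation is contractive. *)
Lemma commutant_gensZ0_incl X : commutant (gensZ 0) X ->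
  forall x v, X (pi (fp_incl PN PZ x) v) = pi (fp_incl PN PZ x) (X v).
Proof.
move=> cX.
have wX y : words setT y ->
    forall v, X (pi (fp_incl PN PZ y) v) = pi (fp_incl PN PZ y) (X v).
  have [b l o m _] := incl_star_rep; have [lX _] := commutant_bop cX.
  elim=> [j a _||c y1 y2 _ h1 _ h2|y1 y2 _ h1 _ h2] v.
  - by rewrite /fp_incl fp_map_emb; exact: (commutant_gensZE a v cX (k := j%:Z)).
  - by rewrite o.
  - by rewrite !l lX h1 h2.
  - by rewrite !m /= h1 h2.
move=> x v; apply/subr0_eq/nm_arbitrarily_small => e e0.
have [lX [C C0 hC]] := commutant_bop cX.
have k0 : 0 < C * nm v + nm (X v) + 1.
  by rewrite ltr_wpDl // addr_ge0 ?mulr_ge0 ?nm_ge0.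
have [y wy xy] := words_dense x (divr_gt0 e0 k0).
have [b l o m _] := incl_star_rep; have contr := rep_contractive incl_star_rep.
have lr u : linear (fun a => pi (fp_incl PN PZ a) u) by move=> c a a'; exact: l.
apply: le_trans (nm_triangle (X (pi (fp_incl PN PZ y) v)) _ _) _.
rewrite -(linB lX) -(linB (lr v)) (wX _ wy) -(linB (lr (X v))).
have h1 := hC (pi (fp_incl PN PZ (x - y)) v).
have h2 := contr (x - y) v; have h3 := contr (y - x) (X v).
have h4 : C * nm (pi (fp_incl PN PZ (x - y)) v) <= C * (nm (x - y) * nm v).
  by rewrite ler_wpM2l.
rewrite nmB in h3.
have h5 : nm (x - y) * (C * nm v + nm (X v) + 1) <= e.
  by rewrite -ler_pdivlMr // ltW.
have := nm_ge0 (x - y); lra.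
Qed.

Lemma algR_gens : algR PN GZ = bicommutant (gensZ 0).
Proof.
rewrite /algR /bicommutant; congr commutant; apply/seteqP; split=> X cX.
  apply: commutant_gensZ; first exact: commutant_bop cX.
  move=> [k|//] a v _; apply: (commutant_comm cX).
  by exists (fp_emb PN k a) => //; rewrite /fp_incl fp_map_emb.
apply: commutantI; first exact: commutant_bop cX.
by move=> _ [x _ <-] v; exact: commutant_gensZ0_incl.
Qed.

Section Shift.
Variable U : GZ -> GZ.
Hypothesis hU : implements (fp_shift PZ) U.

Let U_lin : linear U. Proof. by case: hU => -[]. Qed.
Let U_iso u v : dotp (U u) (U v) = dotp u v. Proof. by case: hU => -[]. Qed.
Let U_xi x : U (pi x xi) = pi (fp_shift PZ x) xi. Proof. by case: hU. Qed.

Lemma U_bop : bop U. Proof. exact: bop_isometry. Qed.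

Lemma U_rdot u v : rdot (U u) (U v) = rdot u v.
Proof. by rewrite /rdot U_iso. Qed.

Lemma U_inverse : exists2 U' : GZ -> GZ, bop U' & cancel U U' /\ cancel U' U.
Proof.
have [U' bU' UU'] := adjoint_exists U_bop.
have cUU' := isometry_adjK U_iso UU'.
exists U' => //; split=> // v.
have [u _ <-] : range U v by case: hU => -[_ _ ->].
by rewrite cUU'.
Qed.

Lemma U_pi (k : int) a v : U (pi (fp_emb PZ k a) v) = pi (fp_emb PZ (k + 1) a) (U v).
Proof. exact: (implements_intertwines U_bop (fun x _ => U_xi x)). Qed.

Lemma iterU_rdot m u v : rdot (iter m U u) (iter m U v) = rdot u v.
Proof. by elim: m => //= m ih; rewrite U_rdot. Qed.

Lemma iterU_inj m : injective (iter m U).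
Proof.
have [U' _ [UK _]] := U_inverse.
by elim: m => [|m ih] u v //= /(can_inj UK) /ih.
Qed.

Lemma iterU_pi m (k : int) a v :
  iter m U (pi (fp_emb PZ k a) v) = pi (fp_emb PZ (k + m%:Z) a) (iter m U v).
Proof.
elim: m => [|m ih] /=; first by rewrite addr0.
by rewrite ih U_pi -addrA -[in RHS]addn1 PoszD.
Qed.

(** The hypothesis says that [T = U^-1 T U] in the sense of matrix elements. *)
Lemma commutes_shiftI T : bop T ->
  (forall x y, words setT x -> words setT y ->
     rdot (T (pi x xi)) (pi y xi) = rdot (T (U (pi x xi))) (U (pi y xi))) ->
  T \o U = U \o T.
Proof.
move=> bT hT; have [U' bU' [UK U'K]] := U_inverse.
suff e : T = U' \o T \o U by apply/funext => v /=; rewrite [in RHS]e /= U'K.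
apply: op_eq_on_words => //; first exact: bop_comp (bop_comp bU' bT) U_bop.
move=> x wx; apply: (rdot_eq_dense (@wordvec_dense _ _ _ _ _ GZ)) => _ [y wy ->] /=.
by rewrite hT // -[RHS]U_rdot U'K.
Qed.

(** The operator [X'] is [U^-m X U^m]; conjugation by [U] renames the indices. *)
Lemma unshift_commutant n m X : commutant (gensZ (n + m)) X ->
  exists2 X', commutant (gensZ n) X' & forall v, iter m U (X' v) = X (iter m U v).
Proof.
move=> cX; have [U' bU' [UK U'K]] := U_inverse.
have itK : cancel (iter m U') (iter m U) by exact: iter_can.
exists (iter m U' \o X \o iter m U); last by move=> v /=; rewrite itK.
apply: commutant_gensZ.
  apply: bop_comp; last by apply: bop_iter; exact: U_bop.
  by apply: bop_comp (commutant_bop cX); exact: bop_iter.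
move=> k a v nk; apply: (@iterU_inj m).
rewrite iterU_pi /= !itK iterU_pi (commutant_gensZE _ _ cX) //.
by rewrite PoszD lerD2r.
Qed.

Lemma shift_commutant m X : commutant (gensZ 0) X ->
  exists2 X', commutant (gensZ m) X' & forall v, iter m U (X v) = X' (iter m U v).
Proof.
move=> cX; have [U' bU' [UK U'K]] := U_inverse.
have itK : cancel (iter m U') (iter m U) by exact: iter_can.
have itK' : cancel (iter m U) (iter m U') by exact: iter_can.
exists (iter m U \o X \o iter m U'); last by move=> v /=; rewrite itK'.
apply: commutant_gensZ.
  apply: bop_comp; last exact: bop_iter.
  by apply: bop_comp (commutant_bop cX); apply: bop_iter; exact: U_bop.
move=> k a v mk /=.
have -> : k = k - m%:Z + m%:Z by rewrite subrK.
rewrite -{1}(itK v) -iterU_pi itK' (commutant_gensZE _ _ cX) ?subr_ge0 //.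
by rewrite iterU_pi.
Qed.

End Shift.
End TwoSidedGNS.
End ShiftInvariance.

Arguments gensZ {R A PZ phiZ} GZ n.

(** * The tail algebra and the fixed points of the shift *)
Section TailAlgebra.
Variables (R : realType) (A : cstarAlgType R[i]).
Variables (PN : freeProduct A nat) (PZ : freeProduct A int).
Variables (phi : PN -> R[i]) (phiZ : PZ -> R[i]).
Hypothesis hspread : spreadable phi.
Hypothesis hshift : phiZ \o fp_shift PZ = phiZ.
Hypothesis hext : phiZ \o fp_incl PN PZ = phi.
Variables (G : gns phi) (GZ : gns phiZ) (U : GZ -> GZ).
Hypothesis hU : implements (fp_shift PZ) U.

Notation piZ := (gns_rep GZ).
Notation xiZ := (gns_vec GZ).
Notation incl := (fp_incl PN PZ).

Let U_xi x : U (piZ x xiZ) = piZ (fp_shift PZ x) xiZ. Proof. by case: hU. Qed.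

(** [W] implements [left_shift n]. It commutes with the generators of index at
    least [n], which that map fixes, and it undoes [U] on words of index below
    [n - 1]. *)
Lemma left_shift_op (n : nat) : exists W : GZ -> GZ,
  [/\ commutant (gensZ GZ n) W, forall u v, rdot (W u) (W v) = rdot u v &
      forall x, words [set j : int | j + 1 < n%:Z] x ->
        W (U (piZ x xiZ)) = piZ x xiZ].
Proof.
have hg x : words setT x -> phiZ (fp_map PZ PZ (left_shift n) x) = phiZ x.
  by move=> wx; exact: (phiZ_left_shift hspread hshift hext n wx).
have [W [bW iW hW]] := implementing_isometry GZ hg.
exists W; split => //.
  apply: commutant_gensZ => // k a v nk.
  by rewrite (implements_intertwines bW hW) /left_shift ltNge nk.
move=> x wx; rewrite U_xi hW; last by apply: (fp_map_words _ _ wx).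
rewrite /fp_shift (fp_map_comp _ _ id [set j : int | j + 1 < n%:Z]) //.
  by rewrite (fp_map_id _ setT) //; apply: words_sub wx.
by move=> j /= jn; rewrite /left_shift jn addrK.
Qed.

(** A tail operator commutes with the isometries [W] of [left_shift_op] for
    every [n], and each matrix element of [T] only involves indices below some
    [n - 1]. *)
Lemma tail_commutes_shift T : tail_algebraZ GZ T -> T \o U = U \o T.
Proof.
move=> tT.
have bT : bop T by exact: commutant_bop (tT 0%N I).
apply: (commutes_shiftI hU bT) => x y wx wy.
have [m n mn j /=||n [wxn wyn]] :=
    @words_exhaust2 _ _ _ _ (fun n => [set j : int | j + 1 < n%:Z]) x y _ _ wx wy.
- lia.
- by move=> j; exists (absz j + 2)%N; rewrite /=; lia.
have [W [cW iW hW]] := left_shift_op n.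
have TW : forall v, T (W v) = W (T v).
  by move=> v; exact: commutant_comm (tT n I) cW v.
by rewrite -[in RHS]iW -TW !hW.
Qed.

Lemma fixed_shiftE : fixed_shift PN U = tail_algebraZ GZ.
Proof.
apply/seteqP; split=> T.
  rewrite /fixed_shift algR_gens => -[RT TU] n _.
  apply: commutantI; first exact: commutant_bop RT.
  move=> X cX v.
  have [X' cX' hX'] := unshift_commutant (n := 0) (m := n) hU cX.
  have TUm w := commutes_iter n w TU.
  have [U' bU' [UK U'K]] := U_inverse hU.
  have itK : cancel (iter n U') (iter n U) by exact: iter_can.
  rewrite -(itK v) -hX' TUm (commutant_comm RT cX') hX' TUm //.
move=> tT; split; last exact: tail_commutes_shift.
by rewrite algR_gens; exact: tT 0%N I.
Qed.

Section Identification.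
Variable V : G -> GZ.
Hypothesis hV : gns_identification V.

Notation pi := (gns_rep G).
Notation xi := (gns_vec G).

Definition gensN (n : nat) : set (G -> G) :=
  [set T | exists (k : nat) a, (n <= k)%N /\ T = pi (fp_emb PN k a)].

Lemma gensN_adj n : adj_closed (gensN n).
Proof.
move=> _ [k [a [nk ->]]]; exists (pi (fp_emb PN k (star a))).
  by exists k, (star a).
have [_ _ _ ->] := fp_emb_morphism PN k.
exact: rep_adj (gns_star_rep G) _.
Qed.

Let V_lin : linear V. Proof. by case: hV. Qed.
Let V_iso u v : dotp (V u) (V v) = dotp u v. Proof. by case: hV. Qed.
Let V_xi x : V (pi x xi) = piZ (incl x) xiZ. Proof. by case: hV. Qed.
Let V_inj : injective V. Proof. exact: isometry_inj. Qed.

Lemma V_bop : bop V. Proof. exact: bop_isometry. Qed.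

Lemma V_rdot u v : rdot (V u) (V v) = rdot u v.
Proof. by rewrite /rdot V_iso. Qed.

Lemma V_pi x v : V (pi x v) = piZ (incl x) (V v).
Proof.
have [b _ _ m _] := incl_star_rep PN GZ.
have : V \o pi x = piZ (incl x) \o V.
  apply: op_eq_on_words.
  - exact: bop_comp V_bop (rep_bop (gns_star_rep G) x).
  - exact: bop_comp (b x) V_bop.
  move=> y wy /=; rewrite -[pi x (pi y xi)]/((pi x \o pi y) xi) -gns_repM.
  by rewrite !V_xi m.
by move=> /(congr1 (@^~ v)).
Qed.

(** The adjoint intertwines the representations too, since [V] does and both
    representations preserve adjoints. So [V \o Vs], the projection onto the
    range of [V], commutes with the one-sided algebra. *)
Lemma V_adjoint : exists Vs : GZ -> G, [/\ bop Vs, adjp V Vs, cancel V Vs &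
  forall x u, Vs (piZ (incl x) u) = pi x (Vs u)].
Proof.
have [Vs bVs VVs] := adjoint_exists V_bop.
exists Vs; split => //; first exact: isometry_adjK VVs.
move=> x u; apply: rdot_eq => w.
have a1 := rep_adj (incl_star_rep PN GZ) x; have a2 := rep_adj (gns_star_rep G) x.
by rewrite a2 !(adjpC VVs) V_pi a1.
Qed.

Section Adjoint.
Variable Vs : GZ -> G.
Hypotheses (bVs : bop Vs) (VVs : adjp V Vs) (VK : cancel V Vs).
Hypothesis Vs_pi : forall x u, Vs (piZ (incl x) u) = pi x (Vs u).

Lemma compress_commutant n X : commutant (gensZ GZ n) X ->
  commutant (gensN n) (Vs \o X \o V).
Proof.
move=> cX; apply: commutantI.
  by apply: bop_comp V_bop; apply: bop_comp bVs (commutant_bop cX).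
move=> _ [k [a [nk ->]]] v /=; rewrite V_pi /fp_incl fp_map_emb.
rewrite (commutant_gensZE _ _ cX) ?lez_nat //.
by rewrite -(fp_map_emb PN) Vs_pi.
Qed.

Lemma extend_commutant n Y : commutant (gensN n) Y ->
  commutant (gensZ GZ n) (V \o Y \o Vs).
Proof.
move=> cY; apply: commutant_gensZ.
  by apply: bop_comp bVs; apply: bop_comp V_bop (commutant_bop cY).
move=> [k|//] a v nk /=.
rewrite -(fp_map_emb PN PZ) Vs_pi (commutant_comm cY); last by exists k, a.
by rewrite V_pi.
Qed.

(** [T] commutes with the projection [V \o Vs], which [extend_commutant] puts in
    the commutant of the generators. *)
Lemma algR_invariant T v : bicommutant (gensZ GZ 0) T -> V (Vs (T (V v))) = T (V v).
Proof.
move=> RT.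
have cid : commutant (gensN 0) id by apply: commutantI => //; exact: bop_id.
by rewrite -[LHS](commutant_comm RT (extend_commutant cid)) /= VK.
Qed.

Lemma restrictionE T : bicommutant (gensZ GZ 0) T -> restriction V T = Vs \o T \o V.
Proof.
move=> RT; apply/funext => v; rewrite /restriction /=.
apply: V_inj; rewrite algR_invariant //.
pose E := [set w | V w = T (V v)].
suff : E (xget 0 E) by [].
by apply: (xgetPex _ (ex_intro E (Vs (T (V v))) _)); exact: algR_invariant.
Qed.

End Adjoint.
End Identification.
End TailAlgebra.

(** * Restriction to the one-sided space *)
Section Restriction.
Variables (R : realType) (A : cstarAlgType R[i]).
Variables (PN : freeProduct A nat) (PZ : freeProduct A int).
Variables (phi : PN -> R[i]) (phiZ : PZ -> R[i]).
Hypothesis hspread : spreadable phi.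
Hypothesis hshift : phiZ \o fp_shift PZ = phiZ.
Hypothesis hext : phiZ \o fp_incl PN PZ = phi.
Variables (G : gns phi) (GZ : gns phiZ) (U : GZ -> GZ).
Hypothesis hU : implements (fp_shift PZ) U.
Variable V : G -> GZ.
Hypothesis hV : gns_identification V.

Notation piZ := (gns_rep GZ).
Notation xiZ := (gns_vec GZ).
Notation incl := (fp_incl PN PZ).
Notation pi := (gns_rep G).
Notation xi := (gns_vec G).

Let U_xi x : U (piZ x xiZ) = piZ (fp_shift PZ x) xiZ. Proof. by case: hU. Qed.
Let V_lin : linear V. Proof. by case: hV. Qed.
Let V_iso u v : dotp (V u) (V v) = dotp u v. Proof. by case: hV. Qed.
Let V_xi x : V (pi x xi) = piZ (incl x) xiZ. Proof. by case: hV. Qed.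
Let V_inj : injective V. Proof. exact: isometry_inj. Qed.
Let Vbop : bop V. Proof. exact: V_bop hV. Qed.
Let Vrdot u v : rdot (V u) (V v) = rdot u v. Proof. exact: V_rdot hV u v. Qed.
Let Ubop : bop U. Proof. exact: U_bop hU. Qed.
Let Urdot u v : rdot (U u) (U v) = rdot u v. Proof. exact: U_rdot hU u v. Qed.
Let itU m u v : rdot (iter m U u) (iter m U v) = rdot u v.
Proof. exact: iterU_rdot hU m u v. Qed.

Lemma iterU_xi m x : words setT x ->
  iter m U (piZ x xiZ) = piZ (fp_map PZ PZ (fun j => j + m%:Z) x) xiZ.
Proof.
move=> wx; elim: m => [|m ih] /=.
  by rewrite (fp_map_id _ setT) // => j _; rewrite addr0.
rewrite ih U_xi /fp_shift (fp_map_comp _ _ (fun j => j + m.+1%:Z) setT) //.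
by move=> j _; rewrite -addrA -[in RHS]addn1 PoszD.
Qed.

(** The indices occurring in [x] are bounded below, so a power of the shift moves
    [pi x xi] into the range of [V]. *)
Lemma iterU_cover x : words setT x ->
  exists m u, iter m U (piZ x xiZ) = V u.
Proof.
move=> wx; have [m wm] := words_int_below wx.
exists m, (pi (fp_map PZ PN (fun j => absz (j + m%:Z)) x) xi).
rewrite iterU_xi // V_xi; congr (piZ _ _).
rewrite /fp_incl (fp_map_comp _ _ (fun j => j + m%:Z) [set j : int | - m%:Z <= j]) //.
by move=> j /=; lia.
Qed.

Section Adjoint.
Variable Vs : GZ -> G.
Hypotheses (bVs : bop Vs) (VVs : adjp V Vs) (VK : cancel V Vs).
Hypothesis Vs_pi : forall x u, Vs (piZ (incl x) u) = pi x (Vs u).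

(** The isometry of the one-sided space implementing the shift of the natural
    numbers: [U] maps the range of [V] into itself. *)
Let Vt := Vs \o U \o V.

Lemma V_Vt u : V (Vt u) = U (V u).
Proof.
have : V \o Vt = U \o V.
  apply: op_eq_on_words.
  - exact: bop_comp Vbop (bop_comp (bop_comp bVs Ubop) Vbop).
  - exact: bop_comp Ubop Vbop.
  move=> x wx; rewrite /Vt /= V_xi U_xi.
  suff -> : fp_shift PZ (incl x) = incl (fp_map PN PN S x) by rewrite -V_xi VK.
  rewrite /fp_shift /fp_incl !(fp_map_comp _ _ (fun j : nat => (j.+1)%:Z) setT) //.
  by move=> j _; rewrite -addn1 PoszD.
by move=> /(congr1 (@^~ u)).
Qed.

Let Vtbop : bop Vt. Proof. exact: bop_comp (bop_comp bVs Ubop) Vbop. Qed.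

Lemma Vt_rdot u v : rdot (Vt u) (Vt v) = rdot u v.
Proof. by rewrite -Vrdot !V_Vt Urdot Vrdot. Qed.

Lemma V_iterVt m u : V (iter m Vt u) = iter m U (V u).
Proof. by elim: m => //= m ih; rewrite V_Vt ih. Qed.

(** The one-sided form of [tail_commutes_shift]. The compression of the isometry
    of [left_shift_op] commutes with [S] and undoes [Vt] on words of small
    index. Since [Vt] is not surjective, this only gives [S = Vt^* S Vt]. *)
Lemma tail_shift_form S : tail_algebra G S ->
  forall u w, rdot (S u) w = rdot (S (Vt u)) (Vt w).
Proof.
move=> tS u w; have bS : bop S by exact: commutant_bop (tS 0%N I).
have [Vts bVts VtVts] := adjoint_exists Vtbop.
suff e : S = Vts \o S \o Vt by rewrite [in LHS]e /= (adjpC VtVts).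
apply: op_eq_on_words => //; first exact: bop_comp (bop_comp bVts bS) Vtbop.
move=> x wx; apply: (rdot_eq_dense (@wordvec_dense _ _ _ _ _ G)) => _ [y wy ->] /=.
rewrite (adjpC VtVts).
have [m n mn j /=||n [wxn wyn]] :=
    @words_exhaust2 _ _ _ _ (fun n => [set j | (j.+1 < n)%N]) x y _ _ wx wy.
- lia.
- by move=> j; exists (j + 2)%N; rewrite /=; lia.
have [W [cW iW hW]] := left_shift_op hspread hshift hext hU n.
have SY := commutant_comm (tS n I) (compress_commutant hV bVs Vs_pi cW).
have WV z : words [set j | (j.+1 < n)%N] z -> W (V (Vt (pi z xi))) = V (pi z xi).
  move=> wz; rewrite V_Vt V_xi hW //.
  by apply: (fp_map_words _ _ wz) => j /=; lia.
have e : Vs (W (V (Vt (pi x xi)))) = pi x xi by rewrite WV // VK.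
rewrite -[in LHS]e; have /= -> := SY (Vt (pi x xi)).
by rewrite (adjpC VVs) -(WV y wyn) iW Vrdot.
Qed.

Lemma tail_adj S S' : tail_algebra G S -> adjp S S' -> bop S' -> tail_algebra G S'.
Proof.
move=> tS SS' bS' n _; apply: commutant_adj SS' bS'; last exact: tS.
exact: commutant_adj_closed (@gensN_adj _ _ _ _ G n).
Qed.

(** By [tail_shift_form] for [S], the square norm of [S Vt u - Vt S u] equals
    [|S Vt u|^2 - |S u|^2], and this vanishes by [tail_shift_form] for the tail
    operator [S^* S]. *)
Lemma tail_commutes_Vt S : tail_algebra G S -> forall u, S (Vt u) = Vt (S u).
Proof.
move=> tS u; have bS : bop S by exact: commutant_bop (tS 0%N I).
have [S' bS' SS'] := adjoint_exists bS.
have tS' := tail_adj tS SS' bS'.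
have tSS : tail_algebra G (S' \o S).
  by move=> n _; apply: commutant_comp; [exact: tS'|exact: tS].
apply/subr0_eq/nm_eq0/eqP; rewrite -sqrf_eq0 nm_sub_sqr -!rdotE.
have /= := tail_shift_form tSS u u; rewrite !(adjpC SS') => e.
by rewrite Vt_rdot -(tail_shift_form tS) -e; apply/eqP; ring.
Qed.

Lemma restriction_mem T : tail_algebraZ GZ T -> tail_algebra G (restriction V T).
Proof.
move=> tT; rewrite (restrictionE hV bVs VK Vs_pi (tT 0%N I)) => n _.
have bT : bop T by exact: commutant_bop (tT 0%N I).
apply: commutantI; first exact: bop_comp (bop_comp bVs bT) Vbop.
move=> X cX v /=; have TX := commutant_comm (tT n I) (extend_commutant hV bVs Vs_pi cX).
by have /= := TX (V v); rewrite VK => ->; rewrite VK.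
Qed.

(** Two tail operators that agree on the range of [V] agree on all its preimages
    under powers of [U], because both commute with [U]. *)
Lemma restriction_inj T1 T2 : tail_algebraZ GZ T1 -> tail_algebraZ GZ T2 ->
  restriction V T1 = restriction V T2 -> T1 = T2.
Proof.
move=> t1 t2 e.
have TV T u : tail_algebraZ GZ T -> T (V u) = V (restriction V T u).
  move=> t; rewrite (restrictionE hV bVs VK Vs_pi (t 0%N I)) /=.
  by rewrite (algR_invariant hV bVs VK Vs_pi _ (t 0%N I)).
have tU := tail_commutes_shift hspread hshift hext hU.
apply: op_eq_on_words.
- exact: commutant_bop (t1 0%N I).
- exact: commutant_bop (t2 0%N I).
move=> x wx; have [m [u e1]] := iterU_cover wx.
apply: (@iterU_inj _ _ _ _ _ U hU m).
by rewrite -(commutes_iter _ _ (tU _ t1)) -(commutes_iter _ _ (tU _ t2)) e1 !TV // e.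
Qed.

(** The operator [T] is determined by [T (U^-m V u) = U^-m V S u]. Values for
    different [m] are compatible since [S] commutes with [Vt]. The adjoint of [T]
    arises from the adjoint of [S] in the same way, so [T] is reduced by the
    range of [V]; this is used to prove that [T] lies in the bicommutant. *)
Lemma restriction_surj S : tail_algebra G S ->
  exists2 T, tail_algebraZ GZ T & restriction V T = S.
Proof.
move=> tS; have bS : bop S by exact: commutant_bop (tS 0%N I).
have [lS [C C0 hC]] := bS.
have SVt := tail_commutes_Vt tS.
have iterSVt (S1 : G -> G) m u : (forall u, S1 (Vt u) = Vt (S1 u)) ->
    S1 (iter m Vt u) = iter m Vt (S1 u).
  by move=> h; elim: m => //= m ih; rewrite h ih.
pose rel v w := exists m u, iter m U v = V u /\ iter m U w = V (S u).
have lift k v u m : iter m U v = V u -> iter (k + m) U v = V (iter k Vt u).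
  by move=> e; rewrite iterD e V_iterVt.
have lU m : linear (iter m U) by have [] := bop_iter m Ubop.
have rlin c v w v' w' : rel v w -> rel v' w' -> rel (c *: v + v') (c *: w + w').
  move=> [m [u [e1 e2]]] [n [u' [e1' e2']]].
  exists (n + m)%N, (c *: iter n Vt u + iter m Vt u').
  rewrite !lU lS !V_lin (lift _ _ _ _ e1) (lift _ _ _ _ e2).
  rewrite (addnC n) (lift _ _ _ _ e1') (lift _ _ _ _ e2').
  by rewrite !iterSVt.
have nU m v : nm (iter m U v) = nm v by apply: isometry_nm => *; exact: itU.
have rbd v w : rel v w -> nm w <= C * nm v.
  move=> [m [u [e1 e2]]]; rewrite -(nU m w) -(nU m v) e1 e2.
  by rewrite !(isometry_nm Vrdot).
have itex m v : exists w, iter m U w = v.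
  have [U' bU' [UK U'K]] := U_inverse hU.
  by exists (iter m U' v); exact: iter_can.
have [v e e0|T [lT bT hT]] := dense_relation_extends C0 rlin rbd.
- have [_ [x wx ->] xe] := @wordvec_dense _ _ _ _ _ GZ v e e0.
  have [m [u e1]] := iterU_cover wx; have [w ew] := itex m (V (S u)).
  by exists (piZ x xiZ), w; split => //; exists m, u.
have Tbop : bop T by split => //; exists C.
have TV u : T (V u) = V (S u) by apply: hT; exists 0, u.
have TU : T \o U = U \o T.
  apply: op_eq_on_words; [exact: bop_comp|exact: bop_comp|].
  move=> x wx /=; have [m [u e1]] := iterU_cover wx; have [w ew] := itex m (V (S u)).
  rewrite (hT (piZ x xiZ) w); last by exists m, u.
  apply: hT; exists m, (Vt u); rewrite -!iterSr /= e1 ew V_Vt SVt V_Vt //.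
have [T' bT' TT'] := adjoint_exists Tbop.
have [S' bS' SS'] := adjoint_exists bS.
have S'Vt := tail_commutes_Vt (tail_adj tS SS' bS').
(* The adjoint of [T] restricts to the adjoint of [S]. *)
have T'V w : T' (V w) = V (S' w).
  apply: (rdot_eq_dense (@wordvec_dense _ _ _ _ _ GZ)) => _ [x wx ->].
  rewrite ![rdot _ (piZ x xiZ)]rdotC -TT'.
  have [m [u e1]] := iterU_cover wx.
  rewrite -(itU m) -(commutes_iter _ _ TU) e1 TV -V_iterVt Vrdot SS' iterSVt //.
  by rewrite -Vrdot V_iterVt -e1 itU.
have RT : bicommutant (gensZ GZ 0) T.
  apply: commutantI => // X cX.
  suff e : T \o X = X \o T by move=> v; have /(congr1 (@^~ v)) := e.
  have bX := commutant_bop cX.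
  apply: op_eq_on_words; [exact: bop_comp|exact: bop_comp|].
  move=> x wx; apply: (rdot_eq_dense (@wordvec_dense _ _ _ _ _ GZ)) => _ [y wy ->] /=.
  have [m1 [u0 e1]] := iterU_cover wx; have [m2 [w0 e2]] := iterU_cover wy.
  set v1 := piZ x xiZ in e1 *; set v2 := piZ y xiZ in e2 *.
  have {}e1 := lift m2 _ _ _ e1; have {}e2 := lift m1 _ _ _ e2.
  rewrite addnC in e2.
  set m := (m2 + m1)%N in e1 e2.
  set u := iter m2 Vt u0 in e1; set w := iter m1 Vt w0 in e2.
  (* After conjugation by [U^m] both vectors lie in the range of [V], and the
     compression of the conjugate [X'] commutes with [S]. *)
  have [X' cX' hX'] := shift_commutant hU m cX.
  have SY := commutant_comm (tS m I) (compress_commutant hV bVs Vs_pi cX').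
  apply/esym.
  rewrite -(itU m) hX' -(commutes_iter _ _ TU) e1 e2 TV.
  rewrite -(adjpC VVs); have /= <- := SY u.
  rewrite SS' (adjpC VVs) -T'V -TT' -e1 -e2 -hX' (commutes_iter _ _ TU).
  exact: itU.
exists T; last first.
  rewrite (restrictionE hV bVs VK Vs_pi RT); apply/funext => v /=.
  by rewrite TV VK.
by rewrite -(fixed_shiftE hspread hshift hext hU); split => //; rewrite algR_gens.
Qed.

End Adjoint.

Lemma restriction_isomorphism :
  star_isomorphism (tail_algebraZ GZ) (tail_algebra G) (restriction V).
Proof.
have [Vs [bVs VVs VK Vs_pi]] := V_adjoint hV.
have rE T : tail_algebraZ GZ T -> restriction V T = Vs \o T \o V.
  by move=> t; apply: (restrictionE hV bVs VK Vs_pi); exact: t 0%N I.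
have inv T v : tail_algebraZ GZ T -> V (Vs (T (V v))) = T (V v).
  by move=> t; apply: (algR_invariant hV bVs VK Vs_pi); exact: t 0%N I.
have tbop T : tail_algebraZ GZ T -> bop T by move=> t; exact: commutant_bop (t 0%N I).
have [lVs _] := bVs.
split.
- split.
  + by move=> T; exact: (restriction_mem bVs VK Vs_pi).
  + move=> T1 T2; rewrite !inE => t1 t2; exact: (restriction_inj bVs VK Vs_pi).
  + by move=> S tS; have [T tT e] := restriction_surj bVs VVs VK Vs_pi tS; exists T.
- move=> c S T tS tT.
  have tST : tail_algebraZ GZ (c \*: S \+ T).
    by move=> n _; apply: bicommutant_lin; [exact: tS|exact: tT].
  by rewrite !rE //; apply/funext => v /=; rewrite lVs.
- move=> S T tS tT.
  have tST : tail_algebraZ GZ (S \o T).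
    by move=> n _; apply: commutant_comp; [exact: tS|exact: tT].
  by rewrite !rE //; apply/funext => v /=; rewrite inv.
move=> S T tS tT aST; rewrite !rE //.
have [lS _] := tbop S tS; have [lr _] := bop_comp (bop_comp bVs (tbop S tS)) Vbop.
apply/(adjoint_ofP _ lr) => u v /=; rewrite (adjpC VVs) -VVs.
by have /(adjoint_ofP _ lS) -> := aST.
Qed.

End Restriction.

(** * Finite permutations *)
Section Permutations.
Context {R : realType} {A : cstarAlgType R[i]}.
Variables (PZ : freeProduct A int) (phiZ : PZ -> R[i]) (GZ : gns phiZ).

Lemma finitary_perm_bound (s : int -> int) : finitary_perm s ->
  exists n : nat, forall k : int, n%:Z <= k -> s k = k.
Proof.
move=> [_ /finite_seqP[l hl]]; exists (\max_(j <- l) `|j|%N).+1 => k nk.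
apply: contrapT => sk.
have kl : k \in l by have : [set i | s i <> i] k by []; rewrite hl.
have : (absz k <= \max_(j <- l) absz j)%N by exact: leq_bigmax_seq.
lia.
Qed.

(** The cycle through [-m, ..., m + 1]: a finite permutation that agrees with the
    shift on [-m, ..., m]. *)
Definition cyclic_shift (m : nat) (j : int) : int :=
  if (- m%:Z <= j) && (j <= m%:Z) then j + 1
  else if j == m%:Z + 1 then - m%:Z else j.

Definition cyclic_unshift (m : nat) (j : int) : int :=
  if (- m%:Z + 1 <= j) && (j <= m%:Z + 1) then j - 1
  else if j == - m%:Z then m%:Z + 1 else j.

Lemma cyclic_shift_finitary m : finitary_perm (cyclic_shift m).
Proof.
split.
  by exists (cyclic_unshift m) => j; rewrite /cyclic_shift /cyclic_unshift;
    do ?case: ifPn; lia.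
apply: (sub_finite_set (B := [set (k%:Z - m%:Z) | k in `I_(m + m + 2)])).
  move=> j /= hj; exists (absz (j + m%:Z)).
    by move: hj; rewrite /= /cyclic_shift; do ?case: ifPn; lia.
  by move: hj; rewrite /= /cyclic_shift; do ?case: ifPn; lia.
exact: finite_image (finite_II _).
Qed.

Variable U : GZ -> GZ.
Hypothesis hU : implements (fp_shift PZ) U.
Variable Us : (int -> int) -> GZ -> GZ.
Hypothesis hUs : forall s, finitary_perm s -> implements (fp_map PZ PZ s) (Us s).

(** The permutation fixes all large indices, hence its unitary commutes with the
    generators of large index. *)
Lemma tail_commutes_perm T s : tail_algebraZ GZ T -> finitary_perm s ->
  T \o Us s = Us s \o T.
Proof.
move=> tT fs; have [n sn] := finitary_perm_bound fs; have [[lW iW _] hW] := hUs fs.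
have bW : bop (Us s) by exact: bop_isometry.
apply/funext => v /=; apply: (commutant_comm (tT n I)).
apply: commutant_gensZ => // k a w nk.
by rewrite (implements_intertwines bW (fun x _ => hW x)) sn.
Qed.

(** A matrix element of [T] involves the indices between [-m] and [m] for some
    [m]; on the corresponding vectors [U] agrees with the unitary of
    [cyclic_shift m], with which [T] commutes. *)
Lemma perm_commutes_shift T : bop T ->
  (forall s, finitary_perm s -> T \o Us s = Us s \o T) -> T \o U = U \o T.
Proof.
move=> bT hT.
apply: (commutes_shiftI hU bT) => x y wx wy.
have [m n mn j /=||m [wxm wym]] := @words_exhaust2 _ _ _ _
    (fun m => [set j : int | (- m%:Z <= j) && (j <= m%:Z)]) x y _ _ wx wy.
- lia.
- by move=> j; exists (absz j); rewrite /=; lia.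
have fs := cyclic_shift_finitary m; have [[_ iW _] hW] := hUs fs.
have UW z : words [set j : int | (- m%:Z <= j) && (j <= m%:Z)] z ->
    U (gns_rep GZ z (gns_vec GZ)) = Us (cyclic_shift m) (gns_rep GZ z (gns_vec GZ)).
  move=> wz; case: hU => _ ->; rewrite hW /fp_shift.
  by rewrite (fp_map_eq _ (cyclic_shift m) wz) // => j; rewrite /cyclic_shift => /= ->.
rewrite !UW //.
have /(congr1 (@^~ (gns_rep GZ x (gns_vec GZ)))) /= -> := hT _ fs.
by rewrite /rdot iW.
Qed.

End Permutations.

Theorem theorem3p2 (R : realType) (A : cstarAlgType R[i])
    (PN : freeProduct A nat) (PZ : freeProduct A int)
    (phi : PN -> R[i]) (hphi : is_state phi) (hspread : spreadable phi)
    (phiZ : PZ -> R[i]) (hphiZ : is_state phiZ)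
    (hshift : phiZ \o fp_shift PZ = phiZ)
    (hext : phiZ \o fp_incl PN PZ = phi)
    (G : gns phi) (GZ : gns phiZ)
    (V : G -> GZ) (hV : gns_identification V)
    (Utau : GZ -> GZ) (hUtau : implements (fp_shift PZ) Utau) :
  [/\ fixed_shift PN Utau = tail_algebraZ GZ,
      star_isomorphism (tail_algebraZ GZ) (tail_algebra G) (restriction V) &
      exchangeable phi ->
      forall Us : (int -> int) -> GZ -> GZ,
        (forall s, finitary_perm s -> implements (fp_map PZ PZ s) (Us s)) ->
        fixed_perm PN Us = fixed_shift PN Utau /\
        fixed_shift PN Utau = tail_algebraZ GZ].
Proof.
have fixedE := fixed_shiftE hspread hshift hext hUtau.
split=> //; first exact: (restriction_isomorphism hspread hshift hext hUtau hV).
move=> _ Us hUs; split=> //; apply/seteqP; split=> T [RT hT]; split=> //.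
  apply: (perm_commutes_shift hUtau hUs) => //.
  by apply: commutant_bop; move: RT; rewrite /algR; exact.
move=> s fs; apply: (tail_commutes_perm hUs) => //.
by rewrite -fixedE.
Qed.
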